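(* Let $G$ be a topological group admitting a faithful uniformly continuous unitary representation. Suppose $G$ is amenable and has property $(T)$. Then $G$ is maximally almost periodic.
   Context: All topological groups are Hausdorff. A uniformly continuous unitary representation of $G$ is a homomorphism $G\to U(\mathcal H)$, $\mathcal H$ a Hilbert space, that is continuous with respect to the uniform operator (operator norm) topology on $U(\mathcal H)$; faithful means injective. $G$ is amenable if every continuous action of $G$ on a (non-empty) compact Hausdorff space admits an invariant regular Borel probability measure. A strongly continuous unitary representation $\pi$ of $G$ has almost invariant vectors if for every $\varepsilon>0$ and every compact $K\subseteq G$ there is a unit vector $\xi$ with $\|\xi-\pi_g\xi\|<\varepsilon$ for all $g\in K$. $G$ has property $(T)$ if every strongly continuous unitary representation of $G$ having almost invariant vectors has an invariant unit vector. $G$ is maximally almost periodic if its continuous finite-dimensional unitary representations separate points. *)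

(* Defs.v *)
From HB Require Import structures.
From mathcomp Require Import all_boot all_order all_algebra.
From mathcomp Require Import all_classical all_reals all_analysis.
From mathcomp Require Export complex.

Set Implicit Arguments.
Unset Strict Implicit.
Unset Printing Implicit Defensive.

Import Order.TTheory GRing.Theory Num.Theory.
Import numFieldNormedType.Exports.

Local Open Scope classical_set_scope.
Local Open Scope ring_scope.

HB.mixin Record isTopologicalGroup G & Group G & Topological G := {
  mulg_continuous : continuous (fun gh : G * G => (gh.1 * gh.2)%g);
  invg_continuous : continuous (fun g : G => (g^-1)%g)
}.

#[short(type="topologicalGroupType")]
HB.structure Definition TopologicalGroup :=
  {G of Group G & Topological G & isTopologicalGroup G}.

(* Complex Hilbert spaces. The scalars are R[i], so the norm `|x| is a
   (nonnegative real) element of R[i]. The inner product is linear in its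
   first argument and conjugate-linear in the second one. *)
HB.mixin Record isHilbert (R : realType) H & CompleteNormedModule R[i] H := {
  inner : {dot H for (@Num.conj R[i])};
  inner_norm : forall x : H, inner x x = `|x| ^+ 2
}.

#[short(type="hilbertType")]
HB.structure Definition Hilbert (R : realType) :=
  {H of CompleteNormedModule R[i] H & isHilbert R H}.

Section UnitaryRepresentations.
Context {R : realType} {G : topologicalGroupType}.

(* That rep 1 is the identity follows from repM and rep_bij. *)
Record unitary_rep (H : hilbertType R) := UnitaryRep {
  rep :> G -> {linear H -> H};
  rep_bij : forall g, bijective (rep g);
  rep_inner : forall g (x y : H), inner (rep g x) (rep g y) = inner x y;
  repM : forall g h (x : H), rep (g * h)%g x = rep g (rep h x)
}.

Definition opnorm (H : hilbertType R) (T : H -> H) : \bar R :=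
  ereal_sup [set (complex.Re `|T x|)%:E | x in [set x : H | `|x| <= 1]].

Definition norm_continuous_rep (H : hilbertType R) (pi : unitary_rep H) : Prop :=
  forall (g0 : G) (e : R), 0 < e ->
    \forall g \near g0, (opnorm (fun x => pi g x - pi g0 x)%R < e%:E)%E.

Definition strongly_continuous_rep (H : hilbertType R) (pi : unitary_rep H) :
    Prop :=
  forall x : H, continuous (fun g : G => pi g x).

Definition faithful_rep (H : hilbertType R) (pi : unitary_rep H) : Prop :=
  injective (fun g => pi g : H -> H).

Definition almost_invariant_vectors (H : hilbertType R)
    (pi : unitary_rep H) : Prop :=
  forall (e : R) (K : set G), 0 < e -> compact K ->
    exists x : H, `|x| = 1 /\
      forall g, K g -> complex.Re `|x - pi g x| < e.

Definition invariant_unit_vector (H : hilbertType R)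
    (pi : unitary_rep H) : Prop :=
  exists x : H, `|x| = 1 /\ forall g, pi g x = x.

Definition finite_dimensional (H : hilbertType R) : Prop :=
  exists (n : nat) (b : 'I_n -> H), forall x : H,
    exists c : 'I_n -> R[i], x = \sum_(i < n) c i *: b i.

End UnitaryRepresentations.

Arguments unitary_rep {R} G H.

Definition borel (X : ptopologicalType) := g_sigma_algebraType (@open X).

Definition regular_measure (R : realType) (X : ptopologicalType)
    (mu : probability (borel X) R) : Prop :=
  forall A : set (borel X), measurable A ->
    mu A = ereal_inf [set mu U | U in [set U | @open X U /\ A `<=` U]] /\
    mu A = ereal_sup [set mu K | K in
      [set K | [/\ @compact X K, measurable (K : set (borel X)) & K `<=` A]]].

Definition continuous_action (G : topologicalGroupType)
    (X : topologicalType) (act : G -> X -> X) : Prop :=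
  [/\ forall x, act 1%g x = x,
      forall g h x, act (g * h)%g x = act g (act h x) &
      continuous (fun gx : G * X => act gx.1 gx.2)].

(* Pointedness of X (a ptopologicalType) encodes that X is non-empty. *)
Definition amenable (R : realType) (G : topologicalGroupType) : Prop :=
  forall (X : ptopologicalType) (act : G -> X -> X),
    compact [set: X] -> hausdorff_space X -> continuous_action act ->
    exists mu : probability (borel X) R, regular_measure mu /\
      forall g (A : set (borel X)), measurable A -> mu (act g @^-1` A) = mu A.

Definition property_T (R : realType) (G : topologicalGroupType) : Prop :=
  forall (H : hilbertType R) (pi : unitary_rep G H),
    strongly_continuous_rep pi -> almost_invariant_vectors pi ->
    invariant_unit_vector pi.

(* On a finite-dimensional space the norm and strong operator topologies
   coincide, so norm_continuous_rep is continuity of the representation. *)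
Definition maximally_almost_periodic (R : realType)
    (G : topologicalGroupType) : Prop :=
  forall g h : G, g <> h ->
    exists (H : hilbertType R) (pi : unitary_rep G H),
      [/\ finite_dimensional H, norm_continuous_rep pi &
          exists x : H, pi g x <> pi h x].

(* Main.v *)
Require Import Defs.
From HB Require Import structures.
From mathcomp Require Import all_boot all_order all_algebra.
From mathcomp Require Import all_classical all_reals all_analysis.
From mathcomp Require Import measurable_realfun spectral.
From mathcomp Require Import ring lra.

(** Let [pi] be a norm-continuous unitary representation of [G] on [H <> 0].
    Amenability gives an invariant probability measure on the compact [G]-space
    obtained by closing up the point evaluations of Lipschitz functions on the
    unit sphere of [H]; a minimax argument turns it into finitely supported
    measures on the sphere that are almost invariant when tested against
    Lipschitz functions.  Such a measure is a density operator [T] of trace 1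
    with [g T g^-1 - T] small in trace norm, so by the Powers-Stormer inequality
    its square root is an almost invariant unit vector of the conjugation
    representation on Hilbert-Schmidt operators.  Property (T) then provides a
    nonzero Hilbert-Schmidt operator commuting with [pi], whose top singular
    space is a finite-dimensional subrepresentation of [pi].

    Given a faithful [pi] and [g, h] not separated by finite-dimensional
    representations, [pi g - pi h] kills every finite-dimensional
    subrepresentation, hence takes values in the orthogonal complement of all
    of them; this complement vanishes by the above, and so [pi g = pi h]. *)

Set Implicit Arguments.
Unset Strict Implicit.
Unset Printing Implicit Defensive.

Import Order.TTheory GRing.Theory Num.Theory.
Import numFieldNormedType.Exports.

Local Open Scope classical_set_scope.
Local Open Scope ring_scope.

Local Notation "x %:C" := (real_complex _ x) : ring_scope.

(** The detour through Hilbert-Schmidt operators is forced: [pi] itself may have no almost invariant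
    vectors, and amenability only provides almost invariant elements of a convex set of trace class
    operators. The square root carries these into a Hilbert space, where property (T) can act. Norm
    continuity enters three times. It moves every Lipschitz coordinate by a small amount uniformly
    over the sphere, which makes the action on the compactification jointly continuous; it passes to
    subrepresentations and to conjugation; and it reduces a compact set of group elements to a
    finite one. Lipschitz test functions suffice because the trace norm is dual to the operator
    norm, and the quadratic form of a contraction is 2-Lipschitz on the sphere. Finite supports let
    all square roots and eigenbases come from Hermitian matrices. The fixed operator obtained at the
    end is nonzero and Hilbert-Schmidt, hence compact, which is why its top singular value is
    attained with finite multiplicity. *)

Definition rnorm (R : realType) (V : normedZmodType R[i]) (x : V) : R :=
  complex.Re `|x|.

(** * Real-valued norms over complex scalars *)

Section RealNorm.
Context {R : realType}.
Implicit Types V : normedZmodType R[i].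

Lemma rnormE V (x : V) : `|x| = (rnorm x)%:C.
Proof. by rewrite RRe_real// normr_real. Qed.

Lemma rnorm_ge0 V (x : V) : 0 <= rnorm x.
Proof. by rewrite -ler0c -rnormE. Qed.

Lemma rnorm0 V : rnorm (0 : V) = 0.
Proof. by rewrite /rnorm normr0. Qed.

Lemma rnorm_eq0 V (x : V) : (rnorm x == 0) = (x == 0).
Proof. by rewrite -[RHS]normr_eq0 rnormE fmorph_eq0. Qed.

Lemma rnorm_gt0 V (x : V) : (0 < rnorm x) = (x != 0).
Proof. by rewrite lt_def rnorm_eq0 rnorm_ge0 andbT. Qed.

Lemma ler_rnormD V (x y : V) : rnorm (x + y) <= rnorm x + rnorm y.
Proof. by rewrite -lecR rmorphD /= -!rnormE ler_normD. Qed.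

Lemma rnormN V (x : V) : rnorm (- x) = rnorm x.
Proof. by rewrite /rnorm normrN. Qed.

Lemma rdistC V (x y : V) : rnorm (x - y) = rnorm (y - x).
Proof. by rewrite -rnormN opprB. Qed.

Lemma ler_rdistD V (z x y : V) : rnorm (x - y) <= rnorm (x - z) + rnorm (z - y).
Proof. by rewrite -{1}(subrK z x) -addrA ler_rnormD. Qed.

Lemma ler_rdist V (x y : V) : rnorm x - rnorm y <= rnorm (x - y).
Proof. by rewrite lerBlDr (le_trans _ (ler_rnormD _ _))// subrK. Qed.

Lemma ler_rnorm_sum V (I : Type) (r : seq I) (P : pred I) (F : I -> V) :
  rnorm (\sum_(i <- r | P i) F i) <= \sum_(i <- r | P i) rnorm (F i).
Proof.
elim/big_ind2 : _ => //; first by rewrite rnorm0.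
by move=> x a y b xa yb; rewrite (le_trans (ler_rnormD _ _))// lerD.
Qed.

Lemma rnormM (a b : R[i]) : rnorm (a * b) = rnorm a * rnorm b.
Proof. by apply: complexI; rewrite rmorphM/= -!rnormE normrM. Qed.

Lemma rnormZ (V : normedModType R[i]) (a : R[i]) (x : V) :
  rnorm (a *: x) = rnorm a * rnorm x.
Proof. by apply: complexI; rewrite rmorphM/= -!rnormE normrZ. Qed.

Lemma rnormC (a : R) : rnorm a%:C = `|a|.
Proof. by apply: complexI; rewrite -rnormE normc_def /= expr0n addr0 sqrtr_sqr. Qed.

Lemma rnorm_normalize (V : normedModType R[i]) (x : V) :
  x != 0 -> rnorm ((rnorm x)^-1%:C *: x) = 1.
Proof.
move=> x0; rewrite rnormZ rnormC ger0_norm ?invr_ge0 ?rnorm_ge0//.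
by rewrite mulVf// rnorm_eq0.
Qed.

Lemma rnormJ (a : R[i]) : rnorm a^* = rnorm a.
Proof. by rewrite /rnorm norm_conjC. Qed.

Lemma conj_real (a : R) : (a%:C)^* = a%:C.
Proof. by rewrite conj_Creal//= complex_real. Qed.

Lemma sqr_rnormE (a : R[i]) : (rnorm a ^+ 2)%:C = a * a^*.
Proof. by rewrite rmorphXn/= -rnormE normCK. Qed.

Lemma normr_Re_le (a : R[i]) : `|complex.Re a| <= rnorm a.
Proof. by rewrite -lecR -rnormE normc_ge_Re. Qed.

End RealNorm.

(** * Inner products: Bessel and Cauchy-Schwarz *)

Section Inner.
Context {R : realType} {H : hilbertType R}.
Implicit Types x y z : H.

Lemma innerC x y : inner x y = (inner y x)^*.
Proof. by rewrite hermC expr0 mul1r. Qed.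

Lemma innerDl x y z : inner (x + y) z = inner x z + inner y z.
Proof. exact: linearDl. Qed.

Lemma innerDr x y z : inner x (y + z) = inner x y + inner x z.
Proof. exact: linearDr. Qed.

Lemma innerBl x y z : inner (x - y) z = inner x z - inner y z.
Proof. exact: linearBl. Qed.

Lemma innerBr x y z : inner x (y - z) = inner x y - inner x z.
Proof. exact: linearBr. Qed.

Lemma innerZl (a : R[i]) x y : inner (a *: x) y = a * inner x y.
Proof. exact: linearZl_LR. Qed.

Lemma innerZr (a : R[i]) x y : inner x (a *: y) = a^* * inner x y.
Proof. exact: linearZr_LR. Qed.

Lemma inner_suml (I : Type) (r : seq I) (P : pred I) (F : I -> H) y :
  inner (\sum_(i <- r | P i) F i) y = \sum_(i <- r | P i) inner (F i) y.
Proof. exact: linear_sumlz. Qed.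

Lemma inner_sumr (I : Type) (r : seq I) (P : pred I) (F : I -> H) x :
  inner x (\sum_(i <- r | P i) F i) = \sum_(i <- r | P i) inner x (F i).
Proof. exact: linear_sumr. Qed.

Lemma inner0l y : inner 0 y = 0. Proof. exact: linear0l. Qed.
Lemma inner0r x : inner x 0 = 0. Proof. exact: linear0r. Qed.

Lemma inner_sqr x : inner x x = (rnorm x ^+ 2)%:C.
Proof. by rewrite inner_norm rnormE -rmorphXn. Qed.

Lemma inner_eq0 x : inner x x = 0 -> x = 0.
Proof.
by move=> /eqP; rewrite inner_norm sqrf_eq0 normr_eq0 => /eqP.
Qed.

Definition orthonormal_family (I : finType) (e : I -> H) :=
  forall i j, inner (e i) (e j) = (i == j)%:R.

Lemma orthonormal_rnorm (I : finType) (e : I -> H) i :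
  orthonormal_family e -> rnorm (e i) = 1.
Proof.
move=> /(_ i i); rewrite eqxx inner_norm => /eqP.
by rewrite sqrp_eq1// /rnorm => /eqP ->.
Qed.

(* [v] minus its projection on the family has nonnegative square norm. *)
Lemma bessel (I : finType) (e : I -> H) (v : H) : orthonormal_family e ->
  \sum_i rnorm (inner v (e i)) ^+ 2 <= rnorm v ^+ 2.
Proof.
move=> oe; rewrite -lecR rmorph_sum/=.
pose u := \sum_i inner v (e i) *: e i.
have uv : inner u v = \sum_i (rnorm (inner v (e i)) ^+ 2)%:C.
  rewrite inner_suml; apply: eq_bigr => i _.
  by rewrite innerZl (innerC (e i)) sqr_rnormE.
have uu : inner u u = \sum_i (rnorm (inner v (e i)) ^+ 2)%:C.
  rewrite {2}/u inner_sumr; apply: eq_bigr => i _.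
  rewrite innerZr inner_suml (bigD1 i)//= innerZl oe eqxx mulr1.
  rewrite big1 ?addr0 ?sqr_rnormE 1?mulrC// => j ji.
  by rewrite innerZl oe (negbTE ji) mulr0.
have vu : inner v u = \sum_i (rnorm (inner v (e i)) ^+ 2)%:C.
  rewrite innerC uv rmorph_sum/=; apply: eq_bigr => i _.
  by rewrite conj_real.
have : 0 <= inner (v - u) (v - u) by rewrite inner_norm exprn_ge0.
by rewrite innerBl !innerBr uv uu vu subrr subr0 subr_ge0 inner_sqr.
Qed.

Lemma cauchy_schwarz x y : rnorm (inner x y) <= rnorm x * rnorm y.
Proof.
have [->|y0] := eqVneq y 0; first by rewrite inner0r !rnorm0 mulr0.
have ny : rnorm y != 0 by rewrite rnorm_eq0.
pose e (_ : unit) := (rnorm y)^-1%:C *: y.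
have oe : orthonormal_family e.
  by move=> [] []; rewrite /e inner_sqr rnorm_normalize// expr1n.
have := bessel x oe; rewrite (bigD1 tt)//= big1 ?addr0; last by case.
rewrite ler_sqr ?nnegrE ?rnorm_ge0// innerZr rnormM rnormJ rnormC.
by rewrite ger0_norm ?invr_ge0 ?rnorm_ge0// ler_pdivrMl ?rnorm_gt0// mulrC.
Qed.

End Inner.

Lemma ltcRe (R : realType) (e : R[i]) :
  0 < e -> 0 < complex.Re e /\ e = (complex.Re e)%:C.
Proof.
move=> e0; have er : (complex.Re e)%:C = e by rewrite RRe_real// gtr0_real.
by split=> //; rewrite -ltcR er.
Qed.

Section NormedConvergence.
Context {R : realType}.

Lemma cvg_rnormP (V : normedModType R[i]) (F : set_system V) {FF : Filter F} (x : V) :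
  F --> x <-> forall e : R, 0 < e -> \forall y \near F, rnorm (x - y) < e.
Proof.
split=> [/cvgrPdist_lt Fx e e0|Fx].
  have := Fx e%:C; rewrite ltcR => /(_ e0); apply: filterS => y.
  by rewrite rnormE ltcR.
apply/cvgrPdist_lt => e /ltcRe[e0 ->].
by apply: filterS (Fx _ e0) => y; rewrite rnormE ltcR.
Qed.

Lemma rnorm_complete (V : completeNormedModType R[i]) (F : set_system V)
    {FF : ProperFilter F} :
  (forall e : R, 0 < e -> exists x, \forall y \near F, rnorm (x - y) < e) ->
  exists l : V, F --> l.
Proof.
move=> Fc; exists (lim F); apply: cauchy_cvg; apply: cauchy_exP => e /ltcRe[e0 ->].
have [x Fx] := Fc _ e0; exists x; apply: filterS Fx => y.
by rewrite -ball_normE /= rnormE ltcR.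
Qed.

End NormedConvergence.

(** * Construction of Hilbert spaces *)

(** Completeness is phrased for filters and squared distances because no norm exists on [ip_space]
    at this stage; [hilbert_of] derives the norm and the uniform structure from [ip]. *)
Record inner_product_data (R : realType) := InnerProductData {
  ip_space :> lmodType R[i];
  ip : ip_space -> ip_space -> R[i];
  ip_linear : forall z, scalar (ip^~ z);
  ip_conj : forall x y, ip x y = (ip y x)^*;
  ip_gt0 : forall x, x != 0 -> 0 < ip x x;
  ip_complete : forall F : set_system ip_space, ProperFilter F ->
    (forall e : R, 0 < e -> exists x, F [set y | ip (x - y) (x - y) < e%:C]) ->
    exists l, forall e : R, 0 < e -> F [set y | ip (l - y) (l - y) < e%:C] }.

Definition hilbert_of (R : realType) (D : inner_product_data R) : Type := D.

HB.instance Definition _ (R : realType) (D : inner_product_data R) :=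
  GRing.Lmodule.on (hilbert_of D).

Section HilbertOf.
Context {R : realType} (D : inner_product_data R).
Local Notation V := (hilbert_of D).
Implicit Types x y z : V.

Definition hip : V -> V -> R[i] := @ip R D.

Lemma hip_bilinear : bilinear_for *%R (Num.conj \; *%R) hip.
Proof.
split=> [z|z] a x y; first exact: ip_linear.
by rewrite /hip ip_conj ip_linear rmorphD rmorphM/= -!ip_conj.
Qed.

HB.instance Definition _ := bilinear_isBilinear.Build _ _ _ _ _ _ hip hip_bilinear.

Lemma hip_hermitian x y : hip x y = (-1) ^+ false * (hip y x)^*.
Proof. by rewrite expr0 mul1r /hip ip_conj. Qed.

HB.instance Definition _ := isHermitianSesquilinear.Build _ _ _ _ hip hip_hermitian.
HB.instance Definition _ := isDotProduct.Build _ _ hip (@ip_gt0 R D).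

Let hipd : {dot V for Num.conj} := hip.

Let dnorm := fun x => sqrtC (hip x x).

Let hip_ge0 x : 0 <= hip x x.
Proof. exact: (dnorm_ge0 hipd). Qed.

Let dnormZ (a : R[i]) x : dnorm (a *: x) = `|a| * dnorm x.
Proof.
by rewrite /dnorm (sesquilinear.dnormZ hipd) sqrtCM ?nnegrE ?exprn_ge0// sqrCK.
Qed.

Let dnorm_eq0 x : dnorm x = 0 -> x = 0.
Proof. by move=> /eqP; rewrite (sqrt_dnorm_eq0 hipd) => /eqP. Qed.

Let dnorm_cs x y : `|hip x y| ^+ 2 <= hip x x * hip y y.
Proof.
have [->|y0] := eqVneq y 0.
  by rewrite (linear0r hipd) normr0 expr0n mulr_ge0.
have yy : 0 < hip y y by exact: ip_gt0.
pose a := hip x y / hip y y.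
have : 0 <= hip (x - a *: y) (x - a *: y) by [].
have aC : a^* * hip y y = (hip x y)^*.
  rewrite rmorphM/= fmorphV/= (_ : (hip y y)^* = hip y y); last first.
    by rewrite conj_Creal// ger0_real.
  by rewrite divfK// gt_eqF.
rewrite (linearBl hipd) !(linearBr hipd) !(linearZl_LR hipd) !(linearZr_LR hipd)/=.
rewrite aC (_ : hip y x = (hip x y)^*); last by rewrite /hip ip_conj.
rewrite subrr subr0 subr_ge0 => /(ler_wpM2r (ltW yy)).
by rewrite mulrAC aC mulrC -normCK.
Qed.

Let dnormD x y : dnorm (x + y) <= dnorm x + dnorm y.
Proof.
rewrite -ler_sqr ?nnegrE ?addr_ge0 ?sqrtC_ge0// sqrrD !sqrtCK.
rewrite (sesquilinear.dnormD hipd) -[leRHS]addrAC lerD2l.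
have xy : `|hip x y| <= dnorm x * dnorm y.
  rewrite -ler_sqr ?nnegrE ?mulr_ge0 ?sqrtC_ge0//.
  by rewrite exprMn !sqrtCK dnorm_cs.
have zr : hip x y + (hip x y)^* \is Num.real.
  by rewrite CrealE rmorphD/= conjCK addrC.
rewrite (le_trans (real_ler_norm zr))// (le_trans (ler_normD _ _))//.
by rewrite norm_conjC mulr2n lerD.
Qed.

HB.instance Definition _ := Lmodule_isNormed.Build R[i] V dnormD dnormZ dnorm_eq0.

Let normE x : `|x| ^+ 2 = hip x x.
Proof. by rewrite [`|x|]/(dnorm x) sqrtCK. Qed.

Let complete (F : set_system V) : ProperFilter F -> cauchy F -> cvg F.
Proof.
move=> FF /cauchyP Fc.
have [e e0|l Fl] := @ip_complete R D F FF.
  have se0 : 0 < (Num.sqrt e)%:C by rewrite ltcR sqrtr_gt0.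
  have [x Fx] := Fc _ se0; exists x; apply: filterS Fx => y.
  rewrite -ball_normE /= => xy; rewrite -[ltLHS]normE -[e]sqr_sqrtr ?ltW//.
  by rewrite rmorphXn ltr_pXn2r// ?nnegrE ?normr_ge0 ?ler0c ?sqrtr_ge0.
apply/cvg_ex; exists l; apply/cvgrPdist_lt => e /ltcRe[e0 ->].
apply: filterS (Fl _ (exprn_gt0 2 e0)) => y /=.
by rewrite -[ltLHS]normE rmorphXn ltr_pXn2r// ?nnegrE ?normr_ge0 ?ler0c ?ltW.
Qed.

HB.instance Definition _ := Uniform_isComplete.Build V complete.
HB.instance Definition _ := isHilbert.Build R V (fun x => esym (normE x)).

End HilbertOf.

(** * Closed subspaces as Hilbert spaces *)

Record closed_subspace (R : realType) (H : hilbertType R) := ClosedSubspace {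
  csubset : set H;
  csubspace_submod : submod_closed (fun x => `[< csubset x >]);
  csubspace_closed : closed csubset }.

Section Subspace.
Context {R : realType} {H : hilbertType R} (W : closed_subspace H).

Definition csub_pred : {pred H} := fun x => `[< csubset W x >].

HB.instance Definition _ :=
  GRing.isSubmodClosed.Build _ _ csub_pred (csubspace_submod W).

Definition csub := {x : H | csub_pred x}.

HB.instance Definition _ := [isSub of csub for @sval H csub_pred].
HB.instance Definition _ := [Choice of csub by <:].
HB.instance Definition _ := [SubChoice_isSubLmodule of csub by <:].

Let csip (x y : csub) : R[i] := inner (val x) (val y).

Let csip_linear z : scalar (csip^~ z).
Proof. by move=> a x y; rewrite /csip linearP innerDl innerZl. Qed.

Let csip_conj x y : csip x y = (csip y x)^*.
Proof. exact: innerC. Qed.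

Let csip_gt0 x : x != 0 -> 0 < csip x x.
Proof. by move=> x0; rewrite neq0_dnorm_gt0. Qed.

Let csip_complete (F : set_system csub) : ProperFilter F ->
    (forall e : R, 0 < e -> exists x, F [set y | csip (x - y) (x - y) < e%:C]) ->
    exists l, forall e : R, 0 < e -> F [set y | csip (l - y) (l - y) < e%:C].
Proof.
move=> FF Fc.
have csipE x y : csip (x - y) (x - y) = (rnorm (val x - val y) ^+ 2)%:C.
  by rewrite /csip -[RHS]inner_sqr linearB.
have [e e0|l Fl] := @rnorm_complete R H (val @ F) _.
  have [x Fx] := Fc _ (exprn_gt0 2 e0); exists (val x).
  suff: F [set y | rnorm (val x - val y) < e] by [].
  apply: filterS Fx => y; rewrite /mkset csipE ltcR.
  by rewrite ltr_pXn2r// nnegrE ?rnorm_ge0// ltW.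
have Wl : csubset W l.
  apply: (@closed_cvg _ _ F FF val (csubset W)) => //; first exact: csubspace_closed.
  by apply: nearW => x; apply/asboolP/(valP x).
exists (exist _ l (introT (asboolP _) Wl)) => e e0.
have se0 : 0 < Num.sqrt e by rewrite sqrtr_gt0.
have /cvg_rnormP/(_ _ se0) Fl' := Fl.
have {}Fl' : F [set y | rnorm (l - val y) < Num.sqrt e] by [].
apply: filterS Fl' => y ly; rewrite /mkset csipE ltcR /=.
by rewrite -[e]sqr_sqrtr ?ltW// ltr_pXn2r// nnegrE ?rnorm_ge0 ?sqrtr_ge0.
Qed.

Definition csub_data :=
  InnerProductData csip_linear csip_conj csip_gt0 csip_complete.

(** Hides the subtype: from here on a closed subspace is an abstract Hilbert space with an isometry
    [J] onto [W]. *)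
Lemma csub_hilbert : exists (V : hilbertType R) (J : {linear V -> H}),
  [/\ forall x y, inner (J x) (J y) = inner x y,
      forall v, csubset W (J v) & forall x, csubset W x -> exists v, J v = x].
Proof.
exists (hilbert_of csub_data), (val : {linear csub -> H}); split=> //.
  by move=> v; apply/asboolP/(valP v).
by move=> x Wx; exists (exist _ x (introT (asboolP _) Wx)).
Qed.

End Subspace.

Definition linear_of (K : nzRingType) (U V : lmodType K) (f : U -> V)
    (fl : linear f) : {linear U -> V} :=
  HB.pack f (GRing.isLinear.Build _ _ _ _ f fl).

(** * Unitary representations *)

Section Opnorm.
Context {R : realType} {H : hilbertType R}.

Lemma opnorm_lt (T : {linear H -> H}) (c : R) :
  (opnorm T < c%:E)%E -> forall x, rnorm (T x) <= c * rnorm x.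
Proof.
move=> Tc x; have [->|x0] := eqVneq x 0; first by rewrite linear0 !rnorm0 mulr0.
have nx : 0 < rnorm x by rewrite rnorm_gt0.
pose y := (rnorm x)^-1%:C *: x.
have ny : rnorm y = 1 by exact: rnorm_normalize.
have : ((rnorm (T y))%:E <= opnorm T)%E.
  by apply: ereal_sup_ubound; exists y => //=; rewrite rnormE ny.
move=> /le_lt_trans /(_ Tc); rewrite lte_fin linearZ/= rnormZ rnormC.
rewrite ger0_norm ?invr_ge0 ?rnorm_ge0// => /ltW.
by rewrite ler_pdivrMl// mulrC.
Qed.

Lemma opnorm_le (T : H -> H) (c : R) :
  (forall x, rnorm x <= 1 -> rnorm (T x) <= c) -> (opnorm T <= c%:E)%E.
Proof.
move=> Tc; apply: ge_ereal_sup => _ [x /= x1 <-]; rewrite lee_fin.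
by apply: Tc; rewrite -lecR -rnormE.
Qed.

End Opnorm.

Section Representations.
Context {R : realType} {G : topologicalGroupType}.
Implicit Types H : hilbertType R.

(** An operator norm bound on [pi g - pi h], stated vectorwise to stay clear of extended real
    suprema. *)
Definition norm_close H (pi : unitary_rep G H) (e : R) (g h : G) :=
  forall x, rnorm (pi g x - pi h x) <= e * rnorm x.

Lemma norm_continuousP H (pi : unitary_rep G H) :
  norm_continuous_rep pi <->
  forall g0 (e : R), 0 < e -> \forall g \near g0, norm_close pi e g g0.
Proof.
split=> pic g0 e e0.
  apply: filterS (pic g0 e e0) => g ge x.
  pose T := linear_of (linearP (pi g \- pi g0)).
  exact: (@opnorm_lt _ _ T).
(* A bound on a supremum is only a weak inequality; halving [e] restores the strict one. *)
have e20 : 0 < e / 2 by rewrite divr_gt0.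
apply: filterS (pic g0 _ e20) => g ge.
apply: (@le_lt_trans _ _ (e / 2)%:E); last first.
  by rewrite lte_fin ltr_pdivrMr// ltr_pMr// ltr1n.
apply: opnorm_le => x x1; rewrite (le_trans (ge x))// ler_piMr//.
by rewrite divr_ge0 ?ltW.
Qed.

Lemma rep_rnorm H (pi : unitary_rep G H) g x : rnorm (pi g x) = rnorm x.
Proof.
apply/eqP; rewrite -(@eqrXn2 _ 2%N) ?rnorm_ge0//.
by rewrite -(inj_eq (@complexI R)) -!inner_sqr rep_inner.
Qed.

Lemma rep1 H (pi : unitary_rep G H) x : pi 1%g x = x.
Proof. by apply: (bij_inj (rep_bij pi 1%g)); rewrite -repM mulg1. Qed.

Lemma repK H (pi : unitary_rep G H) g x : pi g^-1%g (pi g x) = x.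
Proof. by rewrite -repM mulVg rep1. Qed.

Lemma repVK H (pi : unitary_rep G H) g x : pi g (pi g^-1%g x) = x.
Proof. by rewrite -repM mulgV rep1. Qed.

Lemma inner_repl H (pi : unitary_rep G H) g x y :
  inner (pi g x) y = inner x (pi g^-1%g y).
Proof. by rewrite -[RHS](rep_inner pi g) repVK. Qed.

(** Subrepresentations of [pi] are encoded as isometric intertwiners into it, so that they compose
    and carry their own Hilbert space. *)
Definition isometric_intertwiner (V H : hilbertType R) (rho : unitary_rep G V)
    (pi : unitary_rep G H) (J : {linear V -> H}) :=
  (forall x y, inner (J x) (J y) = inner x y) /\
  (forall g v, J (rho g v) = pi g (J v)).

Lemma isometry_rnorm (V H : hilbertType R) (J : {linear V -> H}) :
  (forall x y, inner (J x) (J y) = inner x y) -> forall x, rnorm (J x) = rnorm x.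
Proof.
move=> Ji x; apply/eqP; rewrite -(@eqrXn2 _ 2%N) ?rnorm_ge0//.
by rewrite -(inj_eq (@complexI R)) -!inner_sqr Ji.
Qed.

Lemma intertwiner_norm_continuous (V H : hilbertType R) (rho : unitary_rep G V)
    (pi : unitary_rep G H) (J : {linear V -> H}) :
  isometric_intertwiner rho pi J ->
  norm_continuous_rep pi -> norm_continuous_rep rho.
Proof.
move=> [Ji Jr] /norm_continuousP pic; apply/norm_continuousP => g0 e e0.
apply: filterS (pic g0 e e0) => g ge x; have := ge (J x).
by rewrite -!Jr -linearB !(isometry_rnorm Ji).
Qed.

Lemma intertwiner_comp (U V H : hilbertType R) (sigma : unitary_rep G U)
    (rho : unitary_rep G V) (pi : unitary_rep G H) (I : {linear U -> V}) (J : {linear V -> H}) :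
  isometric_intertwiner sigma rho I -> isometric_intertwiner rho pi J ->
  isometric_intertwiner sigma pi (J \o I).
Proof.
by move=> [Ii Ir] [Ji Jr]; split=> *; rewrite /= ?Ji ?Ii// Ir Jr.
Qed.

Lemma subrepresentation H (pi : unitary_rep G H) (W : closed_subspace H) :
  (forall g x, csubset W x -> csubset W (pi g x)) ->
  exists (V : hilbertType R) (rho : unitary_rep G V) (J : {linear V -> H}),
    [/\ isometric_intertwiner rho pi J, forall v, csubset W (J v) &
        forall x, csubset W x -> exists v, J v = x].
Proof.
move=> Winv; have [V [J [Ji JW WJ]]] := csub_hilbert W.
have Jinj : injective J.
  move=> x y xy; apply/eqP; rewrite -subr_eq0 -rnorm_eq0 -(isometry_rnorm Ji).
  by rewrite linearB xy subrr rnorm0.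
(* The action on [V] is [pi] pulled back through [J]; injectivity of [J] then yields linearity and
   multiplicativity. *)
have [f fE] : exists f : G -> V -> V, forall g v, J (f g v) = pi g (J v).
  have /choice[f fE] (gv : G * V) : exists w, J w = pi gv.1 (J gv.2).
    exact/WJ/Winv/JW.
  by exists (fun g v => f (g, v)) => g v; rewrite fE.
have fl g : linear (f g).
  by move=> a x y; apply: Jinj; rewrite [RHS]linearP !fE !linearP.
have fM g h v : f (g * h)%g v = f g (f h v).
  by apply: Jinj; rewrite !fE repM.
have f1 v : f 1%g v = v by apply: Jinj; rewrite fE rep1.
have fb g : bijective (linear_of (fl g)).
  by exists (f g^-1%g) => v /=; rewrite -fM ?mulVg ?mulgV f1.
have fi g (x y : V) : inner (linear_of (fl g) x) (linear_of (fl g) y) = inner x y.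
  by rewrite -Ji !fE rep_inner Ji.
exists V, (UnitaryRep fb fi fM), J; split=> //; split.
Qed.

End Representations.

(** * Finite orthonormal families *)

Section Orthonormal.
Context {R : realType} {H : hilbertType R}.
Implicit Types (x y v : H).

Local Notation orthonormal := (@orthonormal_family R H _).

Lemma rnorm2_sum (I : finType) (e : I -> H) (a : I -> R[i]) :
  (forall i j, i != j -> inner (e i) (e j) = 0) ->
  rnorm (\sum_i a i *: e i) ^+ 2 = \sum_i rnorm (a i) ^+ 2 * rnorm (e i) ^+ 2.
Proof.
move=> oe; apply: complexI; rewrite -inner_sqr rmorph_sum inner_suml/=.
apply: eq_bigr => i _; rewrite innerZl inner_sumr (bigD1 i)//= innerZr.
rewrite big1 ?addr0; last by move=> j ji; rewrite innerZr oe ?mulr0 1?eq_sym.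
by rewrite mulrA -sqr_rnormE inner_sqr [RHS]rmorphM.
Qed.

Lemma orthonormal_rnorm2_sum (I : finType) (e : I -> H) (a : I -> R[i]) :
  orthonormal e -> rnorm (\sum_i a i *: e i) ^+ 2 = \sum_i rnorm (a i) ^+ 2.
Proof.
move=> oe; rewrite rnorm2_sum => [|i j /negbTE ij]; last by rewrite oe ij.
by apply: eq_bigr => i _; rewrite (orthonormal_rnorm _ oe) expr1n mulr1.
Qed.

Definition spanned (I : finType) (e : I -> H) x :=
  x = \sum_i inner x (e i) *: e i.

Lemma spanned_family (I : finType) (e : I -> H) i :
  orthonormal e -> spanned e (e i).
Proof.
move=> oe; rewrite /spanned (bigD1 i)//= oe eqxx scale1r big1 ?addr0//.
by move=> j ji; rewrite oe eq_sym (negbTE ji) scale0r.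
Qed.

Lemma spannedZ (I : finType) (e : I -> H) (a : R[i]) x :
  spanned e x -> spanned e (a *: x).
Proof.
move=> ex; rewrite /spanned {1}ex scaler_sumr.
by apply: eq_bigr => i _; rewrite innerZl scalerA.
Qed.

Lemma spanned_sum (I : finType) (e : I -> H) (J : finType) (F : J -> H) :
  (forall j, spanned e (F j)) -> spanned e (\sum_j F j).
Proof.
move=> eF; have E : \sum_j F j = \sum_j \sum_i inner (F j) (e i) *: e i.
  by apply: eq_bigr => j _; exact: eF.
rewrite /spanned {1}E exchange_big/=.
by apply: eq_bigr => i _; rewrite inner_suml scaler_suml.
Qed.

Lemma spanned_comb (I : finType) (e : I -> H) (J : finType) (a : J -> R[i])
  (F : J -> H) : (forall j, spanned e (F j)) -> spanned e (\sum_j a j *: F j).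
Proof. by move=> eF; apply: spanned_sum => j; apply: spannedZ. Qed.

Lemma spanned_trans (I J : finType) (e : I -> H) (f : J -> H) x :
  (forall i, spanned f (e i)) -> spanned e x -> spanned f x.
Proof. by move=> fe ->; apply: spanned_comb. Qed.

Lemma parseval (I : finType) (e : I -> H) x : orthonormal e -> spanned e x ->
  rnorm x ^+ 2 = \sum_i rnorm (inner x (e i)) ^+ 2.
Proof. by move=> oe ex; rewrite {1}ex orthonormal_rnorm2_sum. Qed.

(** Spectral theorem: the double sum is the entry of index [k, l] of [P M P^t*], which is
    diagonal. *)
Lemma hermitian_diagonalization n (M : 'M[R[i]]_n) :
  (forall i j, M i j = (M j i)^*) -> exists P : 'M[R[i]]_n,
    P \is unitarymx /\
    forall k l, k != l -> \sum_i \sum_j P k i * (P l j)^* * M i j = 0.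
Proof.
move=> MC; have Mh : M \is hermsymmx.
  apply/is_hermitianmxP; rewrite expr0 scale1r.
  by apply/matrixP => i j; rewrite !mxE MC.
have /orthomx_spectralP Ms := hermitian_normalmx Mh.
have Pu := spectral_unitarymx M.
exists (spectralmx M); split=> // k l kl.
have : (spectralmx M *m M *m (spectralmx M)^t*)%sesqui k l = 0.
  rewrite [in X in _ *m X *m _]Ms mulmxA mulmxA mulmxV ?unitarymx_unit// mul1mx.
  rewrite -mulmxA (unitarymxP Pu) mulmx1.
  by rewrite mxE (negbTE kl).
move=> E0; rewrite -[RHS]E0 mxE exchange_big/=; apply: eq_bigr => j _.
rewrite !mxE mulr_suml; apply: eq_bigr => i _; ring.
Qed.

Definition unitary_comb n (P : 'M[R[i]]_n) (x : 'I_n -> H) k :=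
  \sum_j P k j *: x j.

Lemma inner_unitary_comb n (P : 'M[R[i]]_n) (x y : 'I_n -> H) k l :
  inner (unitary_comb P x k) (unitary_comb P y l) =
  \sum_i \sum_j P k i * (P l j)^* * inner (x i) (y j).
Proof.
rewrite inner_suml; apply: eq_bigr => i _; rewrite innerZl inner_sumr mulr_sumr.
by apply: eq_bigr => j _; rewrite innerZr mulrA.
Qed.

(** Diagonalizes the Gram matrix. Unlike Gram-Schmidt, a unitary change of family preserves the
    operator [\sum_j inner _ (x j) *: x j], which is what the density operators below require. *)
Lemma orthogonalization n (x : 'I_n -> H) : exists P : 'M[R[i]]_n,
  P \is unitarymx /\
  forall k l, k != l -> inner (unitary_comb P x k) (unitary_comb P x l) = 0.
Proof.
pose M : 'M[R[i]]_n := \matrix_(i, j) inner (x i) (x j).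
have [|P [Pu PM]] := @hermitian_diagonalization n M.
  by move=> i j; rewrite !mxE innerC.
exists P; split=> // k l kl; rewrite inner_unitary_comb -[RHS](PM k l kl).
by apply: eq_bigr => i _; apply: eq_bigr => j _; rewrite mxE.
Qed.

Lemma unitary_comb_inv n (x : 'I_n -> H) (P : 'M[R[i]]_n) j :
  P \is unitarymx -> x j = \sum_k (P k j)^* *: unitary_comb P x k.
Proof.
move=> /unitarymxP PP; have {}PP := mulmx1C PP.
under eq_bigr do rewrite scaler_sumr.
rewrite exchange_big/= (bigD1 j)//=.
have E i : \sum_k (P k j)^* * P k i = (j == i)%:R.
  transitivity ((P^t* *m P)%sesqui j i); last by rewrite PP mxE.
  by rewrite mxE; apply: eq_bigr => k _; rewrite !mxE.
under eq_bigr do rewrite scalerA.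
rewrite -scaler_suml E eqxx scale1r big1 ?addr0// => i ij.
under eq_bigr do rewrite scalerA.
by rewrite -scaler_suml E eq_sym (negbTE ij) scale0r.
Qed.

(** Linear dependence needs no case analysis: after unitary orthogonalization it appears as
    vanishing vectors, which are dropped before normalizing the rest. *)
Lemma orthonormal_basis n (x : 'I_n -> H) :
  exists m (e : 'I_m -> H), orthonormal e /\ forall j, spanned e (x j).
Proof.
have [P [Pu oP]] := orthogonalization x.
pose y := unitary_comb P x.
pose A := [set k | y k != 0]%SET.
pose e (a : 'I_#|A|) := (rnorm (y (enum_val a)))^-1%:C *: y (enum_val a).
have oe : orthonormal e.
  move=> a b; have [<-|ab] := eqVneq a b.
    have ya : y (enum_val a) != 0 by have := enum_valP a; rewrite inE.
    by rewrite inner_sqr rnorm_normalize// expr1n.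
  by rewrite innerZl innerZr oP ?mulr0// (inj_eq enum_val_inj).
exists #|A|, e; split=> // j; rewrite (unitary_comb_inv x j Pu).
apply: spanned_comb => k; have [yk|yk] := eqVneq (y k) 0.
  rewrite -/(y k) yk /spanned big1// => i _.
  by rewrite inner0l scale0r.
have kA : k \in A by rewrite inE.
have -> : unitary_comb P x k = (rnorm (y k))%:C *: e (enum_rank_in kA k).
  rewrite /e enum_rankK_in// -/y scalerA -rmorphM/= mulfV ?rnorm_eq0//.
  by rewrite rmorph1 scale1r.
exact/spannedZ/spanned_family.
Qed.

Lemma orthonormal_basis_fin (I : finType) (x : I -> H) :
  exists m (e : 'I_m -> H), orthonormal e /\ forall j, spanned e (x j).
Proof.
have [m [e [oe ex]]] := orthonormal_basis (fun k : 'I_#|I| => x (enum_val k)).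
by exists m, e; split=> // j; have := ex (enum_rank j); rewrite enum_rankK.
Qed.

(** Bessel's inequality for the image of [v] under the adjoint of [A]. Instead of constructing an
    adjoint, one tests [A] on the combination [x] of the [e i] that would be the projection of that
    image. *)
Lemma sum_inner_le (I : finType) (e : I -> H) (A : {linear H -> H}) (c : R) v :
  orthonormal e -> (forall x, rnorm (A x) <= c * rnorm x) ->
  \sum_i rnorm (inner (A (e i)) v) ^+ 2 <= c ^+ 2 * rnorm v ^+ 2.
Proof.
move=> oe Ac; set s := \sum_i _.
have s0 : 0 <= s by apply: sumr_ge0 => i _; rewrite exprn_ge0 ?rnorm_ge0.
have [->|sN0] := eqVneq s 0; first by rewrite mulr_ge0 ?sqr_ge0.
pose x := \sum_i (inner (A (e i)) v)^* *: e i.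
have xs : rnorm x ^+ 2 = s.
  by rewrite orthonormal_rnorm2_sum//; apply: eq_bigr => i _; rewrite rnormJ.
have Axs : inner (A x) v = s%:C.
  rewrite linear_sum inner_suml rmorph_sum; apply: eq_bigr => i _.
  by rewrite linearZ innerZl mulrC -sqr_rnormE.
have sle : s <= c * rnorm x * rnorm v.
  have := cauchy_schwarz (A x) v; rewrite Axs rnormC ger0_norm// => /le_trans.
  by apply; rewrite ler_wpM2r ?rnorm_ge0.
have : s ^+ 2 <= (c * rnorm x * rnorm v) ^+ 2.
  by rewrite ler_sqr ?nnegrE// (le_trans s0).
rewrite expr2 !exprMn xs -mulrA [leRHS]mulrCA.
by rewrite ler_pM2l// lt_def sN0.
Qed.

(* Expanding in a basis of the span of the vectors [S (f a)] reduces the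
   bound to [sum_inner_le]. *)
Lemma sum_comp_le (I J : finType) (e : I -> H) (f : J -> H)
    (S A : {linear H -> H}) (c : R) :
  orthonormal e -> orthonormal f -> (forall i, spanned f (A (e i))) ->
  (forall x, rnorm (A x) <= c * rnorm x) ->
  \sum_i rnorm (S (A (e i))) ^+ 2 <= c ^+ 2 * \sum_a rnorm (S (f a)) ^+ 2.
Proof.
move=> oe off fA Ac.
have [m [h [oh hS]]] := orthonormal_basis_fin (fun a => S (f a)).
have SA i : S (A (e i)) = \sum_a inner (A (e i)) (f a) *: S (f a).
  by rewrite {1}fA linear_sum; apply: eq_bigr => a _; rewrite linearZ.
pose v k := \sum_a (inner (S (f a)) (h k))^* *: f a.
have vE i k : inner (S (A (e i))) (h k) = inner (A (e i)) (v k).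
  rewrite SA inner_suml inner_sumr; apply: eq_bigr => a _.
  by rewrite innerZl innerZr conjCK mulrC.
under eq_bigr => i _.
  rewrite (parseval oh); last by rewrite SA; apply: spanned_comb.
  under eq_bigr do rewrite vE.
  over.
rewrite exchange_big/=.
under [in leRHS]eq_bigr do rewrite (parseval oh (hS _)).
rewrite [in leRHS]exchange_big/= mulr_sumr; apply: ler_sum => k _.
rewrite (le_trans (sum_inner_le (v k) oe Ac))//.
rewrite orthonormal_rnorm2_sum//.
by under [in leLHS]eq_bigr do rewrite rnormJ.
Qed.

End Orthonormal.

(** * The Hilbert space of Hilbert-Schmidt operators *)

Section HilbertSchmidt.
Context {R : realType} {H : hilbertType R}.
Implicit Types (S T U : {linear H -> H}).

Local Notation orthonormal := (@orthonormal_family R H _).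

Definition hs_on (I : finType) (e : I -> H) (S : H -> H) : R :=
  \sum_i rnorm (S (e i)) ^+ 2.

Definition hs_bounded (S : H -> H) := exists C : R,
  forall n (e : 'I_n -> H), orthonormal e -> hs_on e S <= C.

(** The squared Hilbert-Schmidt norm. A supremum over finite orthonormal families replaces the sum
    over an orthonormal basis of [H]; it is meaningful only under [hs_bounded], [sup] having a
    default value otherwise. *)
Definition hs2 (S : H -> H) : R :=
  sup [set r | exists n (e : 'I_n -> H), orthonormal e /\ r = hs_on e S].

Lemma hs2_ub n (e : 'I_n -> H) (S : H -> H) :
  hs_bounded S -> orthonormal e -> hs_on e S <= hs2 S.
Proof.
move=> [C SC] oe; apply: ub_le_sup; last by exists n, e.
by exists C => _ [m [f [off ->]]]; exact: SC.
Qed.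

Lemma empty_orthonormal (e : 'I_0 -> H) : orthonormal e.
Proof. by case. Qed.

Let hs2_nonempty (S : H -> H) :
  [set r | exists n (e : 'I_n -> H), orthonormal e /\ r = hs_on e S] !=set0.
Proof.
exists (hs_on (fun _ : 'I_0 => 0 : H) S), 0%N, (fun=> 0).
by split=> //; exact: empty_orthonormal.
Qed.

Lemma hs2_le (S : H -> H) (C : R) :
  (forall n (e : 'I_n -> H), orthonormal e -> hs_on e S <= C) -> hs2 S <= C.
Proof. by move=> SC; apply: ge_sup => // _ [n [e [oe ->]]]; exact: SC. Qed.

Lemma hs2_near (S : H -> H) (C : R) : hs_bounded S -> C < hs2 S ->
  exists n (e : 'I_n -> H), orthonormal e /\ C < hs_on e S.
Proof.
move=> [D SD] CS; have [_ [n [e [oe ->]]] Ce] := sup_gt (hs2_nonempty S) CS.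
by exists n, e.
Qed.

(** The case of the identity in [sum_comp_le]. This monotonicity turns the supremum [hs2] into a
    limit along [span_filter]. *)
Lemma hs_on_le (I J : finType) (e : I -> H) (f : J -> H) S :
  orthonormal e -> orthonormal f -> (forall i, spanned f (e i)) ->
  hs_on e S <= hs_on f S.
Proof.
move=> oe off ef; rewrite -[leRHS]mul1r -(expr1n _ 2).
by apply: (@sum_comp_le R H I J e f S idfun) => // x; rewrite mul1r.
Qed.

Lemma hs_rnorm S x : hs_bounded S -> rnorm (S x) ^+ 2 <= hs2 S * rnorm x ^+ 2.
Proof.
move=> Sb; have [->|x0] := eqVneq x 0.
  by rewrite linear0 !rnorm0 expr0n mulr0.
have nx : 0 < rnorm x by rewrite rnorm_gt0.
pose e (_ : 'I_1) := (rnorm x)^-1%:C *: x.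
have oe : orthonormal e.
  by move=> i j; rewrite !ord1 eqxx /e inner_sqr rnorm_normalize// expr1n.
have := hs2_ub Sb oe; rewrite /hs_on big_ord1 linearZ/= rnormZ rnormC.
rewrite ger0_norm ?invr_ge0 ?rnorm_ge0// exprMn exprVn.
by rewrite ler_pdivrMl ?exprn_gt0// mulrC.
Qed.

(** Composition on the right destroys orthonormality of the family, so the images [A (e i)] are
    re-expanded in an orthonormal basis of their span. On the left the bound is termwise. *)
Lemma hs2_comp_le S (A : {linear H -> H}) (c : R) : hs_bounded S ->
  (forall x, rnorm (A x) <= c * rnorm x) ->
  hs_bounded (S \o A) /\ hs2 (S \o A) <= c ^+ 2 * hs2 S.
Proof.
move=> Sb Ac; suff SA n (e : 'I_n -> H) : orthonormal e ->
    hs_on e (S \o A) <= c ^+ 2 * hs2 S.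
  by split; [exists (c ^+ 2 * hs2 S); exact: SA|exact: hs2_le].
move=> oe; have [m [f [off fA]]] := orthonormal_basis (fun i => A (e i)).
rewrite (le_trans (sum_comp_le S oe off fA Ac))// ler_wpM2l ?sqr_ge0//.
exact: hs2_ub.
Qed.

Lemma hs2_lcomp_le (S A : H -> H) (c : R) : 0 <= c -> hs_bounded S ->
  (forall x, rnorm (A x) <= c * rnorm x) ->
  hs_bounded (A \o S) /\ hs2 (A \o S) <= c ^+ 2 * hs2 S.
Proof.
move=> c0 Sb Ac; suff SA n (e : 'I_n -> H) : orthonormal e ->
    hs_on e (A \o S) <= c ^+ 2 * hs2 S.
  by split; [exists (c ^+ 2 * hs2 S); exact: SA|exact: hs2_le].
move=> oe; apply: (@le_trans _ _ (c ^+ 2 * hs_on e S)).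
  rewrite mulr_sumr; apply: ler_sum => i _; rewrite -exprMn.
  by rewrite ler_sqr ?nnegrE ?mulr_ge0 ?rnorm_ge0 // Ac.
by rewrite ler_wpM2l ?sqr_ge0// hs2_ub.
Qed.

Lemma hs2_ge0 (S : H -> H) : hs_bounded S -> 0 <= hs2 S.
Proof.
move=> Sb; apply: le_trans (hs2_ub Sb (@empty_orthonormal (fun=> 0))).
by rewrite sumr_ge0// => i _; rewrite exprn_ge0 ?rnorm_ge0.
Qed.

Definition hs_mem (S : H -> H) := linear S /\ hs_bounded S.

Definition hs_pred : {pred H -> H} := fun f => `[< hs_mem f >].

Let sqr_ler_add (a b c d : R) : 0 <= a -> a <= b * c + d ->
  a ^+ 2 <= 2 * (b ^+ 2 * c ^+ 2) + 2 * d ^+ 2.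
Proof.
rewrite -exprMn; move: (b * c) => t a0 atd.
have : 0 <= (t - d) ^+ 2 by exact: sqr_ge0.
have : a ^+ 2 <= (t + d) ^+ 2 by rewrite ler_sqr// nnegrE (le_trans a0).
by nra.
Qed.

Let hs_boundedD (S T : H -> H) (a : R[i]) :
  hs_bounded S -> hs_bounded T -> hs_bounded (a *: S + T).
Proof.
move=> [C SC] [D TD]; exists (2 * (rnorm a ^+ 2 * C) + 2 * D) => n e oe.
apply: (@le_trans _ _ (2 * (rnorm a ^+ 2 * hs_on e S) + 2 * hs_on e T)).
  rewrite /hs_on !mulr_sumr -big_split/=; apply: ler_sum => i _.
  apply: sqr_ler_add; first exact: rnorm_ge0.
  by rewrite (le_trans (ler_rnormD _ _))// rnormZ.
by rewrite lerD// ler_wpM2l ?TD// ler_wpM2l ?sqr_ge0 ?SC.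
Qed.

Lemma hs_submod : submod_closed hs_pred.
Proof.
split=> [|a S T /asboolP[Sl Sb] /asboolP[Tl Tb]].
  apply/asboolP; split=> [a x y|]; first by rewrite /= scaler0 addr0.
  by exists 0 => n e _; rewrite /hs_on big1// => i _; rewrite rnorm0 expr0n.
apply/asboolP; split; last exact: hs_boundedD.
move=> b x y.
rewrite -![(a *: S + T) _]/(a *: S _ + T _) Sl Tl !scalerDr !scalerA (mulrC b).
by rewrite addrACA.
Qed.

HB.instance Definition _ := GRing.isSubmodClosed.Build _ _ hs_pred hs_submod.

Definition hs_op := {S : H -> H | hs_pred S}.

HB.instance Definition _ := [isSub of hs_op for @sval _ hs_pred].
HB.instance Definition _ := [Choice of hs_op by <:].
HB.instance Definition _ := [SubChoice_isSubLmodule of hs_op by <:].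

Definition hs_op_of (f : H -> H) (fm : hs_mem f) : hs_op :=
  exist _ f (introT (asboolP _) fm).

Lemma hs_op_bounded (S : hs_op) : hs_bounded (val S).
Proof. by have /asboolP[] := valP S. Qed.

Lemma hs_op_linear (S : hs_op) : linear (val S).
Proof. by have /asboolP[] := valP S. Qed.

Definition hs_lin (S : hs_op) : {linear H -> H} := linear_of (hs_op_linear S).

Lemma hs_linP (a : R[i]) (S T : hs_op) x :
  hs_lin (a *: S + T) x = a *: hs_lin S x + hs_lin T x.
Proof. by []. Qed.

Lemma hs_linB (S T : hs_op) x : hs_lin (S - T) x = hs_lin S x - hs_lin T x.
Proof. by []. Qed.

Definition fin_family := {n : nat & 'I_n -> H}.

(* Finite orthonormal families, directed by inclusion of their spans. *)
Definition span_filter : set_system fin_family := [set P | exists e0 : fin_family,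
  orthonormal (tagged e0) /\ forall f : fin_family, orthonormal (tagged f) ->
    (forall i, spanned (tagged f) (tagged e0 i)) -> P f].

Let joint_basis (e f : fin_family) : exists h : fin_family,
  [/\ orthonormal (tagged h), forall i, spanned (tagged h) (tagged e i) &
      forall i, spanned (tagged h) (tagged f i)].
Proof.
have [m [h [oh hs]]] := orthonormal_basis_fin
  (fun k : 'I_(tag e) + 'I_(tag f) =>
    match k with inl i => tagged e i | inr j => tagged f j end).
by exists (existT _ m h); split=> // i; [exact: (hs (inl i))|exact: (hs (inr i))].
Qed.

Global Instance span_filter_filter : ProperFilter span_filter.
Proof.
split=> [[e [oe /(_ e oe)]]|].
  by apply => i; exact: spanned_family.
split.
- exists (existT _ 0%N (fun=> 0)); split=> //; exact: empty_orthonormal.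
- move=> P Q [e [oe eP]] [f [off fQ]].
  have [h [oh he hf]] := joint_basis e f.
  exists h; split=> // k ok kh; split.
    by apply: eP => // i; exact: spanned_trans (he i).
  by apply: fQ => // i; exact: spanned_trans (hf i).
- move=> P Q PQ [e [oe eP]]; exists e; split=> // f off ef.
  exact/PQ/eP.
Qed.

Lemma hs_on_cvg (S : hs_op) :
  (fun f : fin_family => (hs_on (tagged f) (hs_lin S))%:C : R[i]^o) @ span_filter
    --> ((hs2 (hs_lin S))%:C : R[i]^o).
Proof.
apply/cvg_rnormP => e e0.
have [n [f [off fS]]] : exists n (e0 : 'I_n -> H), orthonormal e0 /\
    hs2 (hs_lin S) - e < hs_on e0 (hs_lin S).
  by apply: hs2_near (hs_op_bounded S) _; rewrite ltrBlDr ltrDl.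
exists (existT _ n f); split=> // h oh hf /=.
have fh := hs_on_le (hs_lin S) off oh hf.
have hS := hs2_ub (hs_op_bounded S) oh.
rewrite -rmorphB rnormC /= ger0_norm ?subr_ge0// ltrBlDr -ltrBlDl.
exact: lt_le_trans fh.
Qed.

End HilbertSchmidt.

(** * Inner product and completeness of the Hilbert-Schmidt operators *)

Section HilbertSchmidtSpace.
Context {R : realType} {H : hilbertType R}.
Local Notation hs_op := (@hs_op R H).
Local Notation fin_family := (@fin_family R H).
Implicit Types S T U : hs_op.

Lemma polarization (x y : H) :
  inner x y = 4^-1 * ((rnorm (x + y) ^+ 2)%:C - (rnorm (x - y) ^+ 2)%:C
    + 'i * (rnorm (x + 'i *: y) ^+ 2)%:C - 'i * (rnorm (x - 'i *: y) ^+ 2)%:C).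
Proof.
rewrite -!inner_sqr !(innerBl, innerDl) !(innerBr, innerDr).
rewrite !(innerZl, innerZr) conjCi.
have i2 : 'i * 'i = -1 :> R[i] by rewrite -expr2 sqrCi.
apply: (mulfI (_ : 4 != 0)); rewrite ?pnatr_eq0// mulrA mulfV ?pnatr_eq0// mul1r.
move: (inner x x) (inner x y) (inner y x) (inner y y) => a b c d.
ring: i2.
Qed.

Definition hs_ip_on (f : fin_family) S T : R[i] :=
  \sum_i inner (hs_lin S (tagged f i)) (hs_lin T (tagged f i)).

(** Polarization of [hs2]. Sesquilinearity is not visible on this formula; it holds for the finite
    sums [hs_ip_on] and passes to the limit along [span_filter]. *)
Definition hs_ip S T : R[i] :=
  4^-1 * ((hs2 (hs_lin (S + T)))%:C - (hs2 (hs_lin (S - T)))%:C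
    + 'i * (hs2 (hs_lin (S + 'i *: T)))%:C
    - 'i * (hs2 (hs_lin (S - 'i *: T)))%:C).

Lemma hs_ip_cvg S T :
  (fun f : fin_family => hs_ip_on f S T : R[i]^o) @ span_filter --> (hs_ip S T : R[i]^o).
Proof.
have -> : (fun f : fin_family => hs_ip_on f S T) = (fun f : fin_family =>
    4^-1 * ((hs_on (tagged f) (hs_lin (S + T)))%:C
     - (hs_on (tagged f) (hs_lin (S - T)))%:C
     + 'i * (hs_on (tagged f) (hs_lin (S + 'i *: T)))%:C
     - 'i * (hs_on (tagged f) (hs_lin (S - 'i *: T)))%:C)).
  apply/funext => f; rewrite /hs_on !rmorph_sum !mulr_sumr -!sumrB -big_split/=.
  rewrite -sumrB mulr_sumr; apply: eq_bigr => i _; exact: polarization.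
apply: cvgM; first exact: cvg_cst.
have c (S' : hs_op) := @hs_on_cvg R H S'.
have ci (S' : hs_op) : (fun f : fin_family =>
    'i * (hs_on (tagged f) (hs_lin S'))%:C : R[i]^o) @ span_filter
    --> ('i * (hs2 (hs_lin S'))%:C : R[i]^o).
  by apply: cvgM; [exact: cvg_cst|exact: c].
apply: (@cvgB _ R[i]^o _ _ _ _ _ _ _ _ (ci _)).
apply: (@cvgD _ R[i]^o _ _ _ _ _ _ _ _ (ci _)).
exact: (@cvgB _ R[i]^o _ _ _ _ _ _ _ (c _) (c _)).
Qed.

Lemma hs_ip_eq S T (l : R[i]) :
  (fun f : fin_family => hs_ip_on f S T : R[i]^o) @ span_filter --> (l : R[i]^o) ->
  hs_ip S T = l.
Proof. by move=> Sl; apply: (cvg_unique _ (@hs_ip_cvg S T) Sl). Qed.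

Lemma hs_ip_linear U : scalar (hs_ip^~ U).
Proof.
move=> a S T; apply: hs_ip_eq.
have -> : (fun f : fin_family => hs_ip_on f (a *: S + T) U) =
    (fun f : fin_family => a * hs_ip_on f S U + hs_ip_on f T U).
  apply/funext => f; rewrite /hs_ip_on mulr_sumr -big_split/=.
  by apply: eq_bigr => i _; rewrite -innerZl -innerDl.
apply: cvgD; last exact: hs_ip_cvg.
by apply: cvgMl_tmp; exact: (@hs_ip_cvg S U).
Qed.

Lemma hs_ip_conj S T : hs_ip S T = (hs_ip T S)^*.
Proof.
apply: hs_ip_eq; apply/cvg_rnormP => e e0.
have /cvg_rnormP/(_ e e0) TS := @hs_ip_cvg T S.
have {}TS : span_filter [set f | rnorm (hs_ip T S - hs_ip_on f T S) < e] by [].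
suff: span_filter [set f | rnorm ((hs_ip T S)^* - hs_ip_on f S T) < e] by [].
apply: filterS TS => f; rewrite /mkset.
rewrite (_ : hs_ip_on f S T = (hs_ip_on f T S)^*) -?rmorphB ?rnormJ//.
by rewrite rmorph_sum; apply: eq_bigr => i _; rewrite innerC.
Qed.

Lemma hs_ip_sqr S : hs_ip S S = (hs2 (hs_lin S))%:C.
Proof.
apply: hs_ip_eq.
have -> : (fun f : fin_family => hs_ip_on f S S) =
    (fun f : fin_family => (hs_on (tagged f) (hs_lin S))%:C).
  apply/funext => f; rewrite /hs_on rmorph_sum; apply: eq_bigr => i _.
  exact: inner_sqr.
exact: hs_on_cvg.
Qed.

Lemma hs_op_eq0 S : (forall x, hs_lin S x = 0) -> S = 0.
Proof. by move=> S0; apply: val_inj; apply/funext => x; exact: S0. Qed.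

Lemma hs_ip_gt0 S : S != 0 -> 0 < hs_ip S S.
Proof.
move=> S0; rewrite hs_ip_sqr ltcR lt_def hs2_ge0 ?andbT; last exact: hs_op_bounded.
apply: contraNneq S0 => S20; apply/eqP/hs_op_eq0 => x; apply/eqP.
have := hs_rnorm x (hs_op_bounded S : hs_bounded (hs_lin S)).
rewrite S20 mul0r -rnorm_eq0 => Sx.
by rewrite -sqrf_eq0; rewrite eq_le Sx sqr_ge0.
Qed.

Let rnorm_continuous : continuous (@rnorm R H : H -> R).
Proof.
move=> x; apply/(@cvgrPdist_lt _ R^o) => e e0.
have /cvg_rnormP/(_ e e0) : id @ nbhs x --> x by exact: cvg_id.
apply: filterS => y xy /=; rewrite ltr_norml.
have := ler_rdist x y; have := ler_rdist y x; rewrite rdistC; lra.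
Qed.

Let hs_on_cvg_fun (F : set_system hs_op) (L : H -> H) n (e : 'I_n -> H) S :
  ProperFilter F -> (forall x, (fun T => hs_lin T x) @ F --> L x) ->
  (fun T => hs_on e (hs_lin (S - T))) @ F --> hs_on e (hs_lin S \- L).
Proof.
move=> FF FL; rewrite /hs_on; apply: cvg_big => [|i _].
  exact: add_continuous.
have sc : continuous (fun x : H => rnorm x ^+ 2).
  move=> x; apply: (@continuous_comp _ _ _ (@rnorm R H) (fun r => r ^+ 2)).
    exact: rnorm_continuous.
  exact: exprn_continuous.
apply: (@continuous_cvg _ _ _ _ _ _ (fun x => rnorm x ^+ 2)); first exact: sc.
by apply: cvgB; [exact: cvg_cst|exact: FL].
Qed.

Let sqr_rdistD (z x y : H) :
  rnorm (x - y) ^+ 2 <= 2 * rnorm (z - x) ^+ 2 + 2 * rnorm (z - y) ^+ 2.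
Proof.
have := ler_rdistD z x y; rewrite (rdistC x z).
move: (rnorm (x - y)) (rnorm_ge0 (x - y)) => a.
move: (rnorm (z - x)) (rnorm (z - y)) => b c a0 abc.
have : 0 <= (b - c) ^+ 2 by exact: sqr_ge0.
have : a ^+ 2 <= (b + c) ^+ 2 by rewrite ler_sqr// nnegrE (le_trans a0).
by nra.
Qed.

Lemma hs_complete (F : set_system hs_op) : ProperFilter F ->
  (forall e : R, 0 < e -> exists S, F [set T | hs_ip (S - T) (S - T) < e%:C]) ->
  exists L, forall e : R, 0 < e -> F [set T | hs_ip (L - T) (L - T) < e%:C].
Proof.
move=> FF Fc.
have {}Fc (e : R) : 0 < e -> exists S, F [set T | hs2 (hs_lin (S - T)) < e].
  move=> e0; have [S FS] := Fc e e0; exists S; apply: filterS FS => T.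
  by rewrite /mkset hs_ip_sqr ltcR.
(* The pointwise limit exists because evaluation at [x] is bounded by [hs_rnorm]; adding 1 to
   [rnorm x] avoids dividing by zero. *)
have /choice[L FL] (x : H) : exists l : H, (fun T => hs_lin T x) @ F --> l.
  apply: rnorm_complete => e e0.
  have d0 : 0 < (e / (rnorm x + 1)) ^+ 2.
    by rewrite exprn_gt0// divr_gt0// ltr_wpDl ?rnorm_ge0.
  have [S FS] := Fc _ d0.
  exists (hs_lin S x).
  suff: F [set T | rnorm (hs_lin S x - hs_lin T x) < e] by [].
  apply: filterS FS => T ST; rewrite /mkset -hs_linB.
  have n0 : 0 < rnorm x + 1 by rewrite ltr_wpDl ?rnorm_ge0.
  rewrite -(ltr_pXn2r (_ : 0 < 2)%N) ?nnegrE ?rnorm_ge0 ?ltW//.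
  have := hs_rnorm x (hs_op_bounded (S - T) : hs_bounded (hs_lin (S - T))).
  move=> /le_lt_trans; apply.
  move: ST; rewrite /mkset expr_div_n ltr_pdivlMr ?exprn_gt0//.
  apply: le_lt_trans; rewrite ler_wpM2l//; first exact/hs2_ge0/hs_op_bounded.
  by rewrite ler_sqr ?nnegrE ?rnorm_ge0 ?ltW// ltrDl.
have Llin : linear L.
  move=> a x y; apply: (cvg_unique _ (FL (a *: x + y))) => //.
  rewrite (_ : (fun T => hs_lin T _) = fun T => a *: hs_lin T x + hs_lin T y).
    by apply: cvgD; [apply: cvgZl_tmp; exact: FL|exact: FL].
  by apply/funext => T; rewrite linearP.
(* Lower semicontinuity: for a fixed finite family [hs_on] is continuous under pointwise
   convergence, and the bound [e] is a closed condition. *)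
have key (e : R) S n (f : 'I_n -> H) : orthonormal_family f ->
    F [set T | hs2 (hs_lin (S - T)) < e] -> hs_on f (hs_lin S \- L) <= e.
  move=> off FS.
  have fS := @hs_on_cvg_fun F L n f S FF FL.
  have cl : closed [set r : R | r <= e] by exact: closed_le.
  refine (@closed_cvg _ R F FF _ [set r : R | r <= e] cl _ _ fS).
  apply: filterS FS => T ST /=; apply: le_trans (ltW ST).
  exact: hs2_ub (hs_op_bounded (S - T)) off.
have [S0 FS0] := Fc 1 ltr01.
have Lmem : hs_mem L.
  split=> //.
  (* The limit is Hilbert-Schmidt as the difference of [S0] and [S0 - L], the latter being bounded
     by [key]. *)
  have bD : hs_bounded (hs_lin S0 \- L) by exists 1 => n f off; exact: key FS0.
  have Dl : linear (hs_lin S0 \- L).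
    move=> a x y; rewrite -[LHS]/(hs_lin S0 (a *: x + y) - L (a *: x + y)).
    by rewrite linearP Llin opprD addrACA -scalerBr.
  pose D : hs_op := hs_op_of (conj Dl bD).
  have -> : L = hs_lin (S0 - D).
    by apply/funext => x; rewrite hs_linB /= opprB addrC subrK.
  exact: hs_op_bounded.
pose L' : hs_op := hs_op_of Lmem.
exists L' => e e0.
(* Both squared distances to [S] cost [2 * (e / 5)]; the total of four fifths of [e] leaves room for
   strictness. *)
have e50 : 0 < e / 5 by rewrite divr_gt0.
have [S FS] := Fc _ e50.
apply: filterS (FS) => T ST; rewrite /mkset hs_ip_sqr ltcR.
apply: (@le_lt_trans _ _ (4 * (e / 5))); last by lra.
apply: hs2_le => n f off.
apply: (@le_trans _ _ (2 * hs_on f (hs_lin S \- L) + 2 * hs_on f (hs_lin (S - T)))).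
  rewrite /hs_on !mulr_sumr -big_split/=; apply: ler_sum => i _.
  exact: (sqr_rdistD (hs_lin S (f i)) (L (f i)) (hs_lin T (f i))).
have := key _ _ _ f off FS.
have := hs2_ub (hs_op_bounded (S - T)) off.
by move: ST; rewrite /mkset; lra.
Qed.

Definition hs_data :=
  InnerProductData hs_ip_linear hs_ip_conj hs_ip_gt0 hs_complete.

Definition hs_space : hilbertType R := hilbert_of hs_data.

End HilbertSchmidtSpace.

(** * The conjugation representation on Hilbert-Schmidt operators *)

Section ConjugationRepresentation.
Context {R : realType} {G : topologicalGroupType} {H : hilbertType R}.
Variable pi : unitary_rep G H.
Local Notation hs_op := (@hs_op R H).
Implicit Types (S T : hs_op) (g h : G).

Lemma hs_op_comp_mem (A B : {linear H -> H}) (a b : R) S : 0 <= a ->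
  (forall x, rnorm (A x) <= a * rnorm x) ->
  (forall x, rnorm (B x) <= b * rnorm x) ->
  hs_mem (A \o hs_lin S \o B) /\
  hs2 (A \o hs_lin S \o B) <= a ^+ 2 * b ^+ 2 * hs2 (hs_lin S).
Proof.
move=> a0 Aa Bb.
have [bB hB] := hs2_comp_le (hs_op_bounded S : hs_bounded (hs_lin S)) Bb.
have [bA hA] := hs2_lcomp_le (S := hs_lin S \o B) a0 bB Aa.
split; last by rewrite (le_trans hA)// -mulrA ler_wpM2l ?sqr_ge0.
split=> // c x y; rewrite -[LHS]/(A (hs_lin S (B (c *: x + y)))).
by rewrite !linearP.
Qed.

Let pi1 g x : rnorm (pi g x) <= 1 * rnorm x.
Proof. by rewrite mul1r rep_rnorm. Qed.

Definition conj_op g S : hs_op :=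
  hs_op_of (hs_op_comp_mem S ler01 (pi1 g) (pi1 g^-1%g)).1.

Lemma conj_opE g S x : hs_lin (conj_op g S) x = pi g (hs_lin S (pi g^-1%g x)).
Proof. by []. Qed.

Lemma hs_op_ext S T : (forall x, hs_lin S x = hs_lin T x) -> S = T.
Proof. by move=> ST; apply: val_inj; apply/funext => x; exact: ST. Qed.

Lemma conj_op_linear g : linear (conj_op g).
Proof.
move=> a S T; apply: hs_op_ext => x.
by rewrite hs_linP !conj_opE hs_linP linearP.
Qed.

Lemma conj_opM g h S : conj_op (g * h)%g S = conj_op g (conj_op h S).
Proof. by apply: hs_op_ext => x; rewrite !conj_opE invgM !repM. Qed.

Lemma conj_op1 S : conj_op 1%g S = S.
Proof. by apply: hs_op_ext => x; rewrite conj_opE invg1 !rep1. Qed.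

(** Conjugation by any group element is a contraction; applying this to the inverse as well gives
    equality. *)
Lemma hs2_conj_op g S : hs2 (hs_lin (conj_op g S)) = hs2 (hs_lin S).
Proof.
have le h T : hs2 (hs_lin (conj_op h T)) <= hs2 (hs_lin T).
  have [_] := hs_op_comp_mem T ler01 (pi1 h) (pi1 h^-1%g).
  by rewrite expr1n !mul1r.
apply/eqP; rewrite eq_le le/= -{1}(conj_op1 S) -(mulVg g) conj_opM.
exact: le.
Qed.

Local Notation HS := (@hs_space R H).

Definition conj_lin g : {linear HS -> HS} := linear_of (conj_op_linear g).

Lemma conj_bij g : bijective (conj_lin g).
Proof.
by exists (conj_lin g^-1%g) => S /=; rewrite -conj_opM ?mulVg ?mulgV conj_op1.
Qed.

(** As [hs_ip] is polarized from [hs2], preserving [hs2] is enough. *)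
Lemma conj_inner g (S T : HS) : inner (conj_lin g S) (conj_lin g T) = inner S T.
Proof.
pose L : {linear hs_op -> hs_op} := linear_of (conj_op_linear g).
rewrite -[LHS]/(hs_ip (L S) (L T)) -[RHS]/(hs_ip S T) /hs_ip.
have LE U : hs2 (hs_lin (L U)) = hs2 (hs_lin U) by exact: hs2_conj_op.
by rewrite -!linearZ -!linearD -!linearB !LE.
Qed.

Definition conj_rep : unitary_rep G HS :=
  UnitaryRep conj_bij conj_inner conj_opM.

Lemma hs_space_rnorm (S : HS) : rnorm S ^+ 2 = hs2 (hs_lin S).
Proof. by apply: complexI; rewrite -inner_sqr -hs_ip_sqr. Qed.

Lemma norm_close_inv e g h : norm_close pi e g h ->
  forall x, rnorm (pi g^-1%g x - pi h^-1%g x) <= e * rnorm x.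
Proof.
move=> gh x; have := gh (pi h^-1%g x); rewrite rep_rnorm repVK rdistC.
have -> : pi g^-1%g x - pi h^-1%g x = pi g^-1%g (x - pi g (pi h^-1%g x)).
  by rewrite linearB repK.
by rewrite rep_rnorm.
Qed.

(** Splits [g S g^-1 - h S h^-1] into [(g - h) S g^-1] and [h S (g^-1 - h^-1)]; each term costs [e],
    whence the factor 2. *)
Lemma norm_close_conj e g h : 0 <= e -> norm_close pi e g h ->
  norm_close conj_rep (2 * e) g h.
Proof.
move=> e0 gh S.
have gh' := norm_close_inv gh.
pose D := linear_of (linearP (pi g \- pi h)).
pose D' := linear_of (linearP (pi g^-1%g \- pi h^-1%g)).
have [m1 le1] := hs_op_comp_mem (A := D) (B := pi g^-1%g) S e0 gh (pi1 g^-1%g).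
have [m2 le2] := hs_op_comp_mem (A := pi h) (B := D') S ler01 (pi1 h) gh'.
pose T1 : HS := hs_op_of m1.
pose T2 : HS := hs_op_of m2.
have -> : conj_rep g S - conj_rep h S = T1 + T2.
  apply: hs_op_ext => x.
  rewrite -[RHS]/(D (hs_lin S (pi g^-1%g x)) + pi h (hs_lin S (D' x))).
  rewrite -[LHS]/(pi g (hs_lin S (pi g^-1%g x)) - pi h (hs_lin S (pi h^-1%g x))).
  have -> : D' x = pi g^-1%g x - pi h^-1%g x by [].
  have -> (y : H) : D y = pi g y - pi h y by [].
  by rewrite (linearB (hs_lin S)) (linearB (pi h)) addrA subrK.
have n1 : rnorm T1 <= e * rnorm S.
  rewrite -ler_sqr ?nnegrE ?mulr_ge0 ?rnorm_ge0// exprMn !hs_space_rnorm.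
  by rewrite (le_trans le1)// expr1n mulr1.
have n2 : rnorm T2 <= e * rnorm S.
  rewrite -ler_sqr ?nnegrE ?mulr_ge0 ?rnorm_ge0// exprMn !hs_space_rnorm.
  by rewrite (le_trans le2)// expr1n mul1r.
by rewrite (le_trans (ler_rnormD _ _))// -mulrA mulr_natl mulr2n lerD.
Qed.

Lemma conj_rep_norm_continuous : norm_continuous_rep pi -> norm_continuous_rep conj_rep.
Proof.
move=> /norm_continuousP pic; apply/norm_continuousP => g0 e e0.
have e20 : 0 < e / 2 by rewrite divr_gt0.
apply: filterS (pic g0 _ e20) => g /(norm_close_conj (ltW e20)).
by rewrite mulrC divfK// pnatr_eq0.
Qed.

End ConjugationRepresentation.

Lemma norm_strongly_continuous (R : realType) (G : topologicalGroupType)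
    (H : hilbertType R) (pi : unitary_rep G H) :
  norm_continuous_rep pi -> strongly_continuous_rep pi.
Proof.
move=> /norm_continuousP pic x g0; apply/cvg_rnormP => e e0.
have e'0 : 0 < e / (rnorm x + 1) by rewrite divr_gt0// ltr_wpDl ?rnorm_ge0.
apply: filterS (pic g0 _ e'0) => g /(_ x); rewrite rdistC => /le_lt_trans; apply.
rewrite mulrAC ltr_pdivrMr ?ltr_wpDl ?rnorm_ge0//.
by rewrite ltr_pM2l// ltrDl.
Qed.

(** * The top eigenspace of a Hilbert-Schmidt intertwiner *)

Lemma ultra_bounded_cvg (R : realType) (T : Type) (U : set_system T)
    (f : T -> R) (M : R) : UltraFilter U -> U [set x | `|f x| <= M] ->
  exists l : R, f @ U --> l.
Proof.
move=> UU UM.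
have [l [_ fl]] : `[- M, M] `&` cluster (f @ U) !=set0.
  apply: segment_compact.
  suff: U [set x | f x \in `[- M, M]] by [].
  by apply: filterS UM => x; rewrite /mkset in_itv/= ler_norml.
exists l => B lB.
have [//|UC] := in_ultra_setVsetC (f @^-1` B) UU.
have [y []] : ~` B `&` B !=set0 by exact: fl.
by [].
Qed.

Lemma ultra_bounded_cvgC (R : realType) (T : Type) (U : set_system T)
    (f : T -> R[i]) (M : R) : UltraFilter U -> U [set x | rnorm (f x) <= M] ->
  exists z, forall e : R, 0 < e -> U [set x | rnorm (f x - z) < e].
Proof.
move=> UU UM.
have [a fa] : exists a : R, (fun x => complex.Re (f x)) @ U --> a.
  apply: (@ultra_bounded_cvg _ _ _ _ M); apply: filterS UM => x /=.
  exact/le_trans/normr_Re_le.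
have [b fb] : exists b : R, (fun x => complex.Im (f x)) @ U --> b.
  apply: (@ultra_bounded_cvg _ _ _ _ M); apply: filterS UM => x /=.
  apply: le_trans; rewrite /rnorm normc_def /= -sqrtr_sqr ler_wsqrtr//.
  by rewrite lerDr sqr_ge0.
exists (Complex a b) => e e0.
have e20 : 0 < e / 2 by rewrite divr_gt0.
have /(@cvgrPdist_lt _ R^o)/(_ _ e20) Ua := fa.
have /(@cvgrPdist_lt _ R^o)/(_ _ e20) Ub := fb.
have {}Ua : U [set x | `|a - complex.Re (f x)| < e / 2] by [].
have {}Ub : U [set x | `|b - complex.Im (f x)| < e / 2] by [].
apply: filterS (filterI Ua Ub) => x [/= xa xb].
rewrite rdistC; case: (f x) xa xb => u v /= xa xb.
rewrite (_ : Complex a b - Complex u v = (a - u)%:C + 'i%C * (b - v)%:C).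
  rewrite (le_lt_trans (ler_rnormD _ _))// rnormM !rnormC.
  rewrite (_ : rnorm 'i%C = 1) ?mul1r//; last first.
    by rewrite /rnorm normc_def/= expr0n expr1n add0r sqrtr1.
  by rewrite [ltRHS](splitr e) -[_ - u]opprB normrN distrC ltrD// distrC.
by rewrite /real_complex_def; simpc.
Qed.

Section TopEigenspace.
Context {R : realType} {H : hilbertType R}.
Variable S : {linear H -> H}.
Hypothesis Sb : hs_bounded S.
Hypothesis S0 : exists x, S x != 0.

Lemma parallelogram (x y : H) :
  rnorm (x + y) ^+ 2 + rnorm (x - y) ^+ 2 = 2 * rnorm x ^+ 2 + 2 * rnorm y ^+ 2.
Proof.
apply: complexI; rewrite [LHS]rmorphD [RHS]rmorphD/= -!inner_sqr.
rewrite ![(2 * _)%:C]rmorphM !rmorph_nat/= -!inner_sqr.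
rewrite !(innerBl, innerDl) !(innerBr, innerDr); ring.
Qed.

Definition op_norm2 : R := sup [set rnorm (S x) ^+ 2 | x in [set x | rnorm x = 1]].
Local Notation M := op_norm2.

(** The quadratic form of [M - S^* S], whose zeros form the top singular space. Being nonnegative
    and satisfying the parallelogram law, it gives a subspace without constructing the adjoint of
    [S]. *)
Definition defect (x : H) : R := M * rnorm x ^+ 2 - rnorm (S x) ^+ 2.

Let rnorm2_normalize (x : H) : x != 0 ->
  rnorm (S ((rnorm x)^-1%:C *: x)) ^+ 2 = rnorm (S x) ^+ 2 / rnorm x ^+ 2.
Proof.
move=> x0; have nx : 0 < rnorm x by rewrite rnorm_gt0.
rewrite linearZ rnormZ rnormC ger0_norm ?invr_ge0 ?rnorm_ge0//.
by rewrite exprMn exprVn mulrC.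
Qed.

Let has_sup_M : has_sup [set rnorm (S x) ^+ 2 | x in [set x | rnorm x = 1]].
Proof.
split.
  have [x Sx] := S0; have x0 : x != 0.
    by apply: contraNneq Sx => ->; rewrite linear0.
  exists (rnorm (S ((rnorm x)^-1%:C *: x)) ^+ 2), ((rnorm x)^-1%:C *: x) => //=.
  exact: rnorm_normalize.
exists (hs2 S) => _ [x /= x1 <-].
by rewrite (le_trans (hs_rnorm x Sb))// x1 expr1n mulr1.
Qed.

Lemma defect_ge0 x : 0 <= defect x.
Proof.
rewrite subr_ge0; have [->|x0] := eqVneq x 0.
  by rewrite linear0 !rnorm0 expr0n mulr0.
rewrite -ler_pdivrMr ?exprn_gt0 ?rnorm_gt0// -rnorm2_normalize//.
apply: ub_le_sup; first by case: has_sup_M.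
by exists ((rnorm x)^-1%:C *: x) => //=; exact: rnorm_normalize.
Qed.

Lemma op_norm2_gt0 : 0 < M.
Proof.
have [x Sx] := S0; have := defect_ge0 x; rewrite subr_ge0 => le.
have := lt_le_trans (_ : 0 < rnorm (S x) ^+ 2) le; rewrite exprn_gt0 ?rnorm_gt0//.
move=> /(_ isT); rewrite pmulr_lgt0// exprn_gt0// rnorm_gt0.
by apply: contraNneq Sx => ->; rewrite linear0.
Qed.

Lemma defect_parallelogram x y :
  defect (x + y) + defect (x - y) = 2 * defect x + 2 * defect y.
Proof.
rewrite /defect linearB linearD.
have := parallelogram (S x) (S y).
have := congr1 ( *%R M) (parallelogram x y); lra.
Qed.

Lemma defectD_le x y : defect (x + y) <= 2 * defect x + 2 * defect y.
Proof. by rewrite -defect_parallelogram lerDl defect_ge0. Qed.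

Lemma defectZ (a : R[i]) x : defect (a *: x) = rnorm a ^+ 2 * defect x.
Proof. by rewrite /defect [S _]linearZ !rnormZ; ring. Qed.

Lemma defect_le x : defect x <= M * rnorm x ^+ 2.
Proof. by rewrite lerBlDr lerDl exprn_ge0 ?rnorm_ge0. Qed.

Lemma defectN x : defect (- x) = defect x.
Proof. by rewrite /defect linearN !rnormN. Qed.

Lemma orthonormal_extend (n : nat) (e : 'I_n -> H) (u : H) :
  orthonormal_family e -> u != 0 -> (forall i, inner u (e i) = 0) ->
  exists f : 'I_n.+1 -> H, [/\ orthonormal_family f,
    f ord0 = (rnorm u)^-1%:C *: u & forall i, f (lift ord0 i) = e i].
Proof.
move=> oe u0 ue.
pose f i := if unlift ord0 i is Some j then e j else (rnorm u)^-1%:C *: u.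
exists f; rewrite /f unlift_none; split=> // [i j|i]; last by rewrite liftK.
case: unliftP => [i' ->|->]; case: unliftP => [j' ->|->].
- by rewrite oe (inj_eq lift_inj).
- by rewrite innerZr innerC ue conjC0 mulr0 eq_sym (negbTE (neq_lift _ _)).
- by rewrite innerZl ue mulr0 (negbTE (neq_lift _ _)).
- by rewrite inner_sqr rnorm_normalize// expr1n eqxx.
Qed.

(** Quantitative compactness of [S]: choose [e] exhausting [hs2 S] up to [M / 2]. Adjoining to [e] a
    normalized vector orthogonal to it cannot exceed [hs2 S], so [S] contributes at most [M / 2]
    there. *)
Let tail : exists n (e : 'I_n -> H), orthonormal_family e /\
  forall w, (forall i, inner w (e i) = 0) -> M / 2 * rnorm w ^+ 2 <= defect w.
Proof.
have M0 := op_norm2_gt0.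
have lt : hs2 S - M / 2 < hs2 S by rewrite ltrBlDr ltrDl divr_gt0.
have [n [e [oe eS]]] := hs2_near Sb lt.
exists n, e; split=> // w we; have [->|w0] := eqVneq w 0.
  by rewrite rnorm0 expr0n mulr0 defect_ge0.
have [f [off f0 fe]] := orthonormal_extend oe w0 we.
have := hs2_ub Sb off; rewrite /hs_on big_ord_recl f0.
under eq_bigr do rewrite fe.
rewrite -/(hs_on e S) rnorm2_normalize// => fS.
have : rnorm (S w) ^+ 2 / rnorm w ^+ 2 <= M / 2 by lra.
rewrite ler_pdivrMr ?exprn_gt0 ?rnorm_gt0// /defect => le; lra.
Qed.

(* Along an ultrafilter refining the maximizing sequences, the components in
   the span of [e] converge by compactness, and the orthogonal ones form a
   Cauchy filter since [defect] is coercive there. *)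
Lemma top_eigenvector : exists x, x != 0 /\ defect x = 0.
Proof.
have M0 := op_norm2_gt0; have [n [e [oe coer]]] := tail.
pose B (d : R) := [set x : H | rnorm x = 1 /\ defect x < d].
have FB : ProperFilter (filter_from [set d : R | 0 < d] B).
  apply: filter_from_proper.
    apply: filter_from_filter; first by exists 1 => /=.
    move=> c d /= c0 d0; exists (Num.min c d); first by rewrite /= lt_min c0.
    by move=> x [x1]; rewrite lt_min => /andP[].
  move=> d /= d0.
  have [_ [x /= x1 <-] xM] := sup_adherent d0 has_sup_M.
  exists x; split=> //; rewrite /defect x1 expr1n mulr1.
  by move: xM; rewrite -/M; lra.
have [U [UU FU]] := ultraFilterLemma FB.
have UB (d : R) : 0 < d -> U (B d) by move=> d0; apply: FU; exists d.
pose v x := \sum_i inner x (e i) *: e i.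
have ev x i : inner (x - v x) (e i) = 0.
  rewrite innerBl inner_suml (bigD1 i)//= innerZl oe eqxx mulr1 big1 ?addr0 ?subrr//.
  by move=> j ji; rewrite innerZl oe (negbTE ji) mulr0.
have /choice[z Uz] (i : 'I_n) : exists z, forall d : R, 0 < d ->
    U [set x | rnorm (inner x (e i) - z) < d].
  apply: (@ultra_bounded_cvgC _ _ _ _ 1).
  apply: filterS (UB 1 ltr01) => x [x1 _] /=.
  by rewrite (le_trans (cauchy_schwarz _ _))// x1 mul1r (orthonormal_rnorm _ oe).
pose l := \sum_i z i *: e i.
have Uv (d : R) : 0 < d -> U [set x | rnorm (v x - l) < d].
  move=> d0; have dn0 : 0 < d / n.+1%:R by rewrite divr_gt0.
  have : \forall x \near U, forall i, rnorm (inner x (e i) - z i) < d / n.+1%:R.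
    by apply: filter_forall => i; exact: Uz.
  apply: filterS => x xz /=.
  rewrite /v /l -sumrB (le_lt_trans (ler_rnorm_sum _ _ _))//.
  apply: (@le_lt_trans _ _ (\sum_(i < n) d / n.+1%:R)).
    apply: ler_sum => i _; rewrite -scalerBl rnormZ (orthonormal_rnorm _ oe) mulr1.
    exact/ltW/xz.
  rewrite sumr_const card_ord -[_ *+ n]mulr_natr mulrAC ltr_pdivrMr//.
  by rewrite ltr_pM2l// ltr_nat.
(* In [close], the defect of the orthogonal part [w] is at most [(8 + 8 * M) * d ^+ 2], and
   coercivity divides by [M / 2]: this is [t]. Then [K] adds twice [t] to twice the bound 4 for the
   component in the span. *)
pose t := (16 + 16 * M) / M.
pose K : R := 8 + 2 * t.
have K0 : 0 < K.
  by rewrite addr_gt0// mulr_gt0// divr_gt0// addr_gt0// mulr_gt0.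
have close (d : R) x y : 0 < d -> rnorm (v x - l) < d -> rnorm (v y - l) < d ->
    defect x < d ^+ 2 -> defect y < d ^+ 2 -> rnorm (x - y) ^+ 2 <= K * d ^+ 2.
  move=> d0 xl yl dx dy.
  pose w := (x - v x) - (y - v y).
  have we i : inner w (e i) = 0 by rewrite innerBl !ev subrr.
  have vv : rnorm (v x - v y) ^+ 2 <= 4 * d ^+ 2.
    rewrite (_ : 4 * d ^+ 2 = (2 * d) ^+ 2); last by ring.
    have d2 : 0 <= 2 * d by rewrite mulr_ge0// ltW.
    rewrite ler_sqr ?nnegrE ?rnorm_ge0//.
    by rewrite (le_trans (ler_rdistD l _ _))// (rdistC l); lra.
  have xyE : x - y = w + (v x - v y).
    by rewrite /w addrACA subrK -opprD subrK.
  have dw : defect w <= (16 + 16 * M) / 2 * d ^+ 2.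
    have -> : w = (x - y) - (v x - v y) by rewrite xyE addrK.
    have := defectD_le (x - y) (- (v x - v y)); rewrite defectN.
    have := defectD_le x (- y); rewrite defectN.
    have := defect_le (v x - v y).
    have : M * rnorm (v x - v y) ^+ 2 <= M * (4 * d ^+ 2) by rewrite ler_wpM2l// ltW.
    lra.
  have wn : rnorm w ^+ 2 <= t * d ^+ 2.
    rewrite /t -mulrA mulrCA -ler_pdivrMl ?invr_gt0// invrK.
    have := coer w we; lra.
  have : rnorm (x - y) ^+ 2 <= 2 * rnorm w ^+ 2 + 2 * rnorm (v x - v y) ^+ 2.
    by rewrite xyE -parallelogram lerDl exprn_ge0 ?rnorm_ge0.
  rewrite /K; lra.
have [x Ux] : exists x : H, U --> x.
  apply: rnorm_complete => r r0.
  pose d := r / (K + 1).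
  have K1 : 0 < K + 1 by rewrite addr_gt0.
  have d0 : 0 < d by rewrite divr_gt0.
  have Ud : U ([set x | rnorm (v x - l) < d] `&` B (d ^+ 2)).
    by apply: filterI; [exact: Uv|exact/UB/exprn_gt0].
  have [x [/= xl [_ dx]]] := filter_ex Ud.
  exists x; apply: filterS Ud => y [/= yl [_ dy]].
  rewrite -(ltr_pXn2r (_ : 0 < 2)%N) ?nnegrE ?rnorm_ge0 ?ltW//.
  rewrite (le_lt_trans (close d x y d0 xl yl dx dy))// /d expr_div_n.
  rewrite mulrA ltr_pdivrMr ?exprn_gt0// mulrC ltr_pM2l ?exprn_gt0//.
  by nra.
have /cvg_rnormP {}Ux := Ux.
have near (d : R) : 0 < d -> exists y, [/\ rnorm (x - y) < d, rnorm y = 1 & defect y < d].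
  move=> d0; have Uxd : U [set y | rnorm (x - y) < d] by exact: Ux.
  have [y [/= xy [y1 dy]]] := filter_ex (filterI Uxd (UB d d0)).
  by exists y.
exists x; split.
  have [y [xy y1 _]] := near 1 ltr01; rewrite -rnorm_gt0.
  have := ler_rdist y x; rewrite y1 rdistC; lra.
apply/eqP; rewrite eq_le defect_ge0 andbT; apply/ler_addgt0Pr => r r0.
rewrite add0r.
(* The minimum with 1 bounds the square of the distance by the distance; [2 * M] copies come from
   [x - y] and 2 from [y]. *)
have r'0 : 0 < Num.min 1 (r / (2 * M + 2)).
  by rewrite lt_min ltr01 divr_gt0// addr_gt0// mulr_gt0.
have [y [xy y1 dy]] := near _ r'0.
have := defectD_le (x - y) y; rewrite subrK => /le_trans; apply.
have := defect_le (x - y).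
move: xy dy; rewrite !lt_min => /andP[xy1 xyr] /andP[_ dyr].
have : rnorm (x - y) ^+ 2 <= r / (2 * M + 2).
  apply: le_trans (ltW xyr); rewrite expr2 ler_piMl ?rnorm_ge0//.
  exact: ltW.
have M22 : 0 < 2 * M + 2 by rewrite addr_gt0// mulr_gt0.
have rE : r = (2 * M + 2) * (r / (2 * M + 2)) by rewrite mulrC divfK// gt_eqF.
move=> /(ler_wpM2l (ltW M0)); lra.
Qed.

End TopEigenspace.

(** * Finite dimension of the top singular space *)

Section FiniteDimension.
Context {R : realType} {H : hilbertType R}.
Variable S : {linear H -> H}.
Hypothesis Sb : hs_bounded S.
Hypothesis S0 : exists x, S x != 0.

Lemma top_submod : submod_closed (fun x => `[< defect S x = 0 >]).
Proof.
split=> [|a x y /asboolP x0 /asboolP y0]; apply/asboolP.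
  by rewrite /defect linear0 !rnorm0 expr0n mulr0 subrr.
apply/eqP; rewrite eq_le defect_ge0// andbT.
by rewrite (le_trans (defectD_le Sb S0 _ _))// defectZ x0 y0 !mulr0 addr0.
Qed.

Lemma top_closed : closed [set x | defect S x = 0].
Proof.
move=> x clx; apply/eqP; rewrite eq_le defect_ge0// andbT.
have M0 := op_norm2_gt0 Sb S0.
apply/ler_addgt0Pr => r r0; rewrite add0r.
have sr0 : 0 < Num.sqrt (r / (2 * op_norm2 S)).
  by rewrite sqrtr_gt0 divr_gt0// mulr_gt0.
have /cvg_rnormP/(_ _ sr0) nx : id @ nbhs x --> x by exact: cvg_id.
have [y [/= y0 xy]] := clx _ nx.
have := defectD_le Sb S0 (x - y) y; rewrite subrK y0 mulr0 addr0 => /le_trans; apply.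
have := defect_le S (x - y).
have : rnorm (x - y) ^+ 2 <= r / (2 * op_norm2 S).
  have q0 : 0 <= r / (2 * op_norm2 S) by rewrite ltW// divr_gt0// mulr_gt0.
  rewrite -[leRHS](sqr_sqrtr q0) ler_sqr ?nnegrE ?rnorm_ge0 ?sqrtr_ge0//.
  exact: ltW.
move=> /(ler_wpM2l (ltW M0)).
have -> : op_norm2 S * (r / (2 * op_norm2 S)) = r / 2.
  by field; rewrite gt_eqF.
lra.
Qed.

Definition top_space : closed_subspace H := ClosedSubspace top_submod top_closed.

(** An orthonormal family of maximal length spans, since a nonzero remainder would extend it. *)
Lemma orthonormal_bounded_finite (V : hilbertType R) (N : nat) :
  (forall n (e : 'I_n -> V), orthonormal_family e -> (n <= N)%N) ->
  finite_dimensional V.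
Proof.
move=> VN.
pose P n := `[< exists e : 'I_n -> V, orthonormal_family e >].
have P0 : exists n, P n by exists 0%N; apply/asboolP; exists (fun=> 0) => -[].
have PN n : P n -> (n <= N)%N by move=> /asboolP[e /VN].
have /asboolP[e oe] : P (ex_maxn P0 PN) by case: ex_maxnP.
exists (ex_maxn P0 PN), e => x; exists (fun i => inner x (e i)).
apply/eqP; rewrite -subr_eq0; apply/negPn/negP => u0.
have [i|f [off _ _]] := orthonormal_extend oe u0.
  rewrite innerBl inner_suml (bigD1 i)//= innerZl oe eqxx mulr1.
  rewrite big1 ?addr0 ?subrr// => j ji.
  by rewrite innerZl oe (negbTE ji) mulr0.
move: e oe x u0 f off; case: ex_maxnP => m _ mmax e _ x _ f off.
have /mmax : P m.+1 by apply/asboolP; exists f.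
by rewrite ltnn.
Qed.

(** Unitaries commuting with [S] preserve [defect S], hence the top space. Each unit vector there
    contributes [op_norm2 S] to [hs2 S], which bounds the length of orthonormal families by the
    quotient. *)
Lemma commutant_subrepresentation (G : topologicalGroupType)
    (pi : unitary_rep G H) : (forall g x, S (pi g x) = pi g (S x)) ->
  exists (V : hilbertType R) (rho : unitary_rep G V) (J : {linear V -> H}),
    [/\ isometric_intertwiner rho pi J, finite_dimensional V &
        exists v : V, v != 0].
Proof.
move=> Spi.
have [|V [rho [J [Jr JW WJ]]]] := @subrepresentation R G H pi top_space.
  move=> g x /= x0; rewrite /defect Spi !rep_rnorm; exact: x0.
exists V, rho, J; split=> //.
  have M0 := op_norm2_gt0 Sb S0.
  apply: (@orthonormal_bounded_finite V (Num.truncn (hs2 S / op_norm2 S))) => n e oe.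
  have oJ : orthonormal_family (J \o e).
    by move=> i j /=; rewrite Jr.1 oe.
  rewrite truncn_ge_nat; last first.
    by rewrite divr_ge0 ?hs2_ge0// ltW.
  rewrite ler_pdivlMr//; apply: le_trans (hs2_ub Sb oJ).
  rewrite /hs_on -[X in X%:R]card_ord -sum1_card natr_sum mulr_suml ler_sum// => i _.
  have := JW (e i); rewrite /= /defect (orthonormal_rnorm _ oJ) => /eqP.
  by rewrite subr_eq0 expr1n mulr1 => /eqP <-; rewrite mul1r.
have [x [x0 dx]] := top_eigenvector Sb S0.
have [v Jv] := WJ x dx; exists v; apply: contraNneq x0 => v0.
by rewrite -Jv v0 linear0.
Qed.

End FiniteDimension.

(** * Almost invariant measures on the unit sphere *)

Lemma borel_measurable_fun (R : realType) (X : ptopologicalType) (u : X -> R) :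
  continuous u -> measurable_fun [set: borel X] (u : borel X -> R).
Proof.
move=> /continuousP cu; apply: (measurability _ (RGenOpens.measurableE R)).
move=> _ [_ [a [b ->] <-]]; rewrite setTI.
by apply: sub_sigma_algebra; apply: cu; exact: interval_open.
Qed.

Lemma borel_measurable_map (X : ptopologicalType) (f : X -> X) :
  continuous f -> measurable_fun [set: borel X] (f : borel X -> borel X).
Proof.
move=> /continuousP cf.
apply: (measurability _ (erefl : @measurable _ (borel X) = <<s @open X >>)).
move=> _ [A oA <-]; rewrite setTI.
by apply: sub_sigma_algebra; exact: cf.
Qed.

Section InvariantMeasure.
Context {R : realType} {G : topologicalGroupType}.
Hypothesis G_amenable : amenable R G.

(** The integral of [u i (act (g i) x) - u i x] against an invariant probability measure vanishes,
    whereas a uniform drift would make the sum integrate to at least [d]. Only this finitary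
    consequence of amenability is used later. *)
Lemma amenable_no_drift (X : ptopologicalType) (act : G -> X -> X) (n : nat)
    (g : 'I_n -> G) (u : 'I_n -> X -> R) (d : R) :
  compact [set: X] -> hausdorff_space X -> continuous_action act ->
  (forall i, continuous (u i)) -> (forall i x, `|u i x| <= 1) -> 0 < d ->
  ~ forall x, d <= \sum_i (u i (act (g i) x) - u i x).
Proof.
move=> cX hX aact cu u1 d0 drift.
have [mu [_ muinv]] := G_amenable cX hX aact.
have muT : mu [set: borel X] = 1%E := probability_setT mu.
have icst (r : R) : (\int[mu]_x (cst r%:E) x = r%:E)%E.
  by rewrite integral_cst//; apply: etrans (mule1 _); congr (_ * _)%E.
have cact h : continuous (act h).
  case: aact => _ _ /= c x.
  apply: (@continuous_comp _ _ _ (fun x => (h, x))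
    (fun gx => act gx.1 gx.2)); last exact: c.
  by apply: cvg_pair => /=; [exact: cvg_cst|exact: cvg_id].
have mact h := borel_measurable_map (cact h).
(* Since [u i] is at least -1, adding 1 gives nonnegative integrands. *)
pose U i (x : borel X) : \bar R := (u i x + 1)%:E.
pose V i (x : borel X) : \bar R := (u i (act (g i) x) + 1)%:E.
have mU i : measurable_fun [set: borel X] (U i).
  apply/measurable_EFinP; apply: measurable_funD; last exact: measurable_cst.
  exact: borel_measurable_fun.
have mV i : measurable_fun [set: borel X] (V i).
  exact: (measurableT_comp (mU i) (mact (g i))).
have U0 i x : (0 <= U i x)%E.
  by rewrite lee_fin; have := u1 i x; rewrite ler_norml => /andP[]; lra.
have V0 i x : (0 <= V i x)%E by exact: U0.
have UV i : (\int[mu]_x U i x = \int[mu]_x V i x)%E.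
  have := ge0_integral_pushforward (mact (g i)) mu measurableT (mU i) (fun x _ => U0 i x).
  rewrite preimage_setT => <-.
  by apply: eq_measure_integral => A mA _; exact/esym/muinv.
have Ufin i : (\int[mu]_x U i x)%E \is a fin_num.
  rewrite ge0_fin_numE; last exact: integral_ge0.
  apply: (@le_lt_trans _ _ (\int[mu]_x (cst 2%:E x))%E).
    apply: ge0_le_integral => //= x _; rewrite lee_fin.
    by have := u1 i x; rewrite ler_norml => /andP[]; lra.
  by rewrite icst ltry.
have : (\int[mu]_x (d%:E + \sum_(i < n) U i x) <= \int[mu]_x \sum_(i < n) V i x)%E.
  apply: ge0_le_integral => //.
  - by move=> x _; apply: adde_ge0; [rewrite lee_fin ltW|exact: sume_ge0].
  - by apply: emeasurable_funD; [exact: measurable_cst|exact: emeasurable_sum].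
  - exact: emeasurable_sum.
  - move=> x _; rewrite /U /V !sumEFin -EFinD lee_fin.
    by have := drift x; rewrite sumrB !big_split/=; lra.
rewrite ge0_integralD//; last 3 first.
- by move=> x _; rewrite lee_fin ltW.
- by move=> x _; apply: sume_ge0.
- exact: emeasurable_sum.
rewrite !ge0_integral_sum// -[X in (X + _)%E]/(\int[mu]_x (cst d%:E) x)%E icst.
under [X in (_ <= X)%E]eq_bigr do rewrite -UV.
under eq_bigr do rewrite -(fineK (Ufin _)).
under [X in (_ <= X)%E]eq_bigr do rewrite -(fineK (Ufin _)).
by rewrite sumEFin -EFinD lee_fin gerDr leNgt d0.
Qed.

End InvariantMeasure.

(** * Pointwise convergence and subspaces *)

Lemma ptws_cvgP (I : Type) (T : topologicalType) (F : set_system {ptws I -> T})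
    (phi : {ptws I -> T}) : Filter F ->
  (forall i, (fun f : {ptws I -> T} => f i) @ F --> phi i) -> F --> phi.
Proof.
move=> FF Fi; apply/cvg_sup => i U [V [[W oW <-] Wphi] VU].
apply: filterS VU _; apply: Fi; exact: open_nbhs_nbhs.
Qed.

Lemma ptws_continuous (Y : topologicalType) (I : Type) (T : topologicalType)
    (f : Y -> {ptws I -> T}) :
  (forall i, continuous (fun y => f y i)) -> continuous f.
Proof.
by move=> fc y; apply: ptws_cvgP => i; exact: (fc i y).
Qed.

Lemma set_type_cvg (T : topologicalType) (A : set T) (F : set_system (set_type A))
    (x : set_type A) : Filter F -> val @ F --> val x -> F --> x.
Proof.
move=> FF Fx B /= [_ [[W oW <-] Wx] WB].
apply: filterS WB _; apply: Fx; exact: open_nbhs_nbhs.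
Qed.

Lemma set_type_compact (T : topologicalType) (A : set T) :
  compact A -> compact [set: set_type A].
Proof.
move=> cA F FF _.
have [|p [Ap clp]] := cA (val @ F) _.
  suff : F [set x | A (val x)] by [].
  by apply: filterE => x; exact: (set_mem (valP x)).
exists (exist _ p (mem_set Ap)); split=> // B C FB.
move=> [_ [[W oW <-] Wp] WC].
have FB' : (val @ F) (val @` B).
  suff : F [set x | (val @` B) (val x)] by [].
  by apply: filterS FB => x Bx; exists x.
have [_ [[x Bx <-] Wx]] := clp _ _ FB' (open_nbhs_nbhs (conj oW Wp)).
by exists x; split=> //; exact: WC.
Qed.

Lemma set_type_hausdorff (T : topologicalType) (A : set T) :
  hausdorff_space T -> hausdorff_space (set_type A).
Proof.
move=> hT x y xy; apply: val_inj; apply: hT => B C Bx Cy.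
have cv : continuous (val : set_type A -> T) by exact: initial_continuous.
have [z [Bz Cz]] := xy _ _ (cv x B Bx) (cv y C Cy).
by exists (val z).
Qed.

(** * A compact space of means on the unit sphere *)

Section SphereMean.
Context {R : realType} {G : topologicalGroupType} {H : hilbertType R}.
Variable pi : unitary_rep G H.

Definition sphere_lip (f : H -> R) :=
  (forall x, rnorm x = 1 -> `|f x| <= 1) /\
  (forall x y, rnorm x = 1 -> rnorm y = 1 -> `|f x - f y| <= rnorm (x - y)).

Lemma sphere_lip_rep (f : H -> R) g :
  sphere_lip f -> sphere_lip (fun x => f (pi g x)).
Proof.
move=> [f1 fl]; split=> [x x1|x y x1 y1]; first by rewrite f1// rep_rnorm.
by rewrite (le_trans (fl _ _ _ _)) ?rep_rnorm// -linearB rep_rnorm.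
Qed.

Lemma sphere_lip_repE (f : H -> R) g :
  sphere_lip (fun x => f (pi g x)) = sphere_lip f.
Proof.
apply/propext; split=> [/(@sphere_lip_rep _ g^-1%g)|]; last exact: sphere_lip_rep.
by under eq_fun do rewrite repVK.
Qed.

Local Notation P := {ptws (H -> R) -> R}.

(** Coordinates are indexed by all functions; those that are not [sphere_lip] are set to 0, so that
    every coordinate lies in [[-1, 1]] for unit [x] and Tychonoff's theorem applies. *)
Definition sphere_eval (x : H) : P :=
  fun f => if `[< sphere_lip f >] then f x else 0.

Definition sphere_compactification : set P :=
  closure [set sphere_eval x | x in [set x | rnorm x = 1]].

Local Notation K := sphere_compactification.

Lemma sphere_approx (psi : P) (I : finType) (f : I -> H -> R) (e : R) : K psi -> 0 < e ->
  exists x, rnorm x = 1 /\ forall i, `|psi (f i) - sphere_eval x (f i)| < e.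
Proof.
move=> Kpsi e0.
have near : nbhs psi [set phi : P | forall i, `|psi (f i) - phi (f i)| < e].
  have FF : Filter (nbhs psi) := nbhs_filter psi.
  apply: (filter_forall FF) => i.
  have c := @proj_continuous _ (fun=> R) (f i) psi.
  by have /(@cvgrPdist_lt _ R^o)/(_ _ e0) := c.
by have [_ [[x /= x1 <-] xe]] := Kpsi _ near; exists x.
Qed.

Lemma sphere_eval_bounded x f : rnorm x = 1 -> `|sphere_eval x f| <= 1.
Proof.
by move=> x1; rewrite /sphere_eval; case: asboolP => [[f1 _]|_]; rewrite ?f1 ?normr0.
Qed.

Lemma sphere_compact : compact K.
Proof.
have cB : compact [set f : P | forall i, (`[(-1 : R), 1]%classic : set R) (f i)].
  apply: (@tychonoff _ (fun=> R) (fun=> `[(-1 : R), 1]%classic)) => i.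
  exact: segment_compact.
apply: subclosed_compact cB _; first exact: closed_closure.
move=> psi Kpsi f /=; rewrite in_itv/= -ler_norml.
apply/ler_addgt0Pr => e e0.
have [x [x1 /(_ ord0) xe]] := sphere_approx (fun _ : 'I_1 => f) Kpsi e0.
have := sphere_eval_bounded f x1.
have := ler_normD (psi f - sphere_eval x f) (sphere_eval x f); rewrite subrK; lra.
Qed.

Definition sphere_act (g : G) (psi : P) : P := fun f => psi (fun x => f (pi g x)).

Lemma sphere_act_eval g x : sphere_act g (sphere_eval x) = sphere_eval (pi g x).
Proof. by apply/funext => f; rewrite /sphere_act /sphere_eval sphere_lip_repE. Qed.

Lemma sphere_act_continuous g : continuous (sphere_act g).
Proof.
apply: ptws_continuous => f.
exact: (@proj_continuous _ (fun _ : H -> R => R) (fun x => f (pi g x))).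
Qed.

Lemma sphere_act_stable g psi : K psi -> K (sphere_act g psi).
Proof.
move=> Kpsi B /(@sphere_act_continuous g psi B) /Kpsi[_ [[x /= x1 <-]]].
rewrite sphere_act_eval => Bx; exists (sphere_eval (pi g x)); split=> //.
by exists (pi g x); rewrite //= rep_rnorm.
Qed.

(** For point evaluations this is the Lipschitz condition, and it survives in the closure. The bound
    is uniform in [psi], which is what joint continuity of the action requires. *)
Lemma sphere_act_close (psi : P) (f : H -> R) g h (e : R) : K psi ->
  0 <= e -> norm_close pi e g h -> `|sphere_act g psi f - sphere_act h psi f| <= e.
Proof.
move=> Kpsi e0 gh; apply/ler_addgt0Pr => r r0.
have r20 : 0 < r / 2 by rewrite divr_gt0.
pose fs (b : 'I_2) : H -> R := fun x => f (pi (if b == ord0 then g else h) x).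
have [x [x1 xe]] := sphere_approx fs Kpsi r20.
have := xe ord0; have := xe (lift ord0 ord0); rewrite /fs /= => xh xg.
have : `|sphere_eval x (fun x => f (pi g x)) - sphere_eval x (fun x => f (pi h x))| <= e.
  rewrite /sphere_eval !sphere_lip_repE; case: asboolP => [[_ fl]|_]; last first.
    by rewrite subrr normr0.
  by rewrite (le_trans (fl _ _ _ _)) ?rep_rnorm// (le_trans (gh x))// x1 mulr1.
move: xg xh; rewrite /sphere_act.
move: (psi _) (psi _) (sphere_eval _ _) (sphere_eval _ _) => a b c d.
rewrite !ltr_norml !ler_norml => /andP[? ?] /andP[? ?] /andP[? ?].
by apply/andP; split; lra.
Qed.

Hypothesis G_amenable : amenable R G.
Hypothesis pic : norm_continuous_rep pi.

(* The closure of the point evaluations on the unit sphere is a compact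
   [G]-space, on which bounded Lipschitz functions extend continuously. *)
Lemma no_sphere_drift n (g : 'I_n -> G) (f : 'I_n -> H -> R) (d : R) :
  (exists x : H, rnorm x = 1) -> (forall i, sphere_lip (f i)) -> 0 < d ->
  ~ forall x, rnorm x = 1 -> d <= \sum_i (f i (pi (g i) x) - f i x).
Proof.
move=> [x0 x01] fl d0 drift.
have K0 : K (sphere_eval x0) by apply: subset_closure; exists x0.
pose X : ptopologicalType := HB.pack (set_type K)
  (isPointed.Build (set_type K) (exist (fun p => p \in K) _ (mem_set K0))).
have KX (psi : X) : K (val psi) by exact: (set_mem (valP psi)).
pose act (h : G) (psi : X) : X :=
  exist (fun p => p \in K) (sphere_act h (val psi))
    (mem_set (@sphere_act_stable h _ (KX psi))).
have cX : compact [set: X] by exact/set_type_compact/sphere_compact.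
have hX : hausdorff_space X.
  apply: set_type_hausdorff; apply: hausdorff_product => ?; exact: Rhausdorff.
have cval : continuous (val : X -> P) by exact: initial_continuous.
have cev (k : H -> R) : continuous (fun psi : X => (val psi : P) k).
  have pk := @proj_continuous _ (fun _ : H -> R => R) k.
  by move=> psi B kB; exact: (cval psi _ (pk (val psi) B kB)).
have aact : continuous_action act.
  split=> [psi|h k psi|].
  - apply: val_inj; apply/funext => k; rewrite /= /sphere_act.
    by congr (val psi _); apply/funext => x; rewrite rep1.
  - apply: val_inj; apply/funext => l; rewrite /= /sphere_act.
    by congr (val psi _); apply/funext => x; rewrite repM.
  move=> [h psi] /=; apply: set_type_cvg; apply: ptws_cvgP => k /=.
  apply/(@cvgrPdist_lt _ R^o) => e e0.
  have e20 : 0 < e / 2 by rewrite divr_gt0.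
  have /norm_continuousP/(_ h _ e20) nh := pic.
  have /(@cvgrPdist_lt _ R^o)/(_ _ e20) npsi := cev (fun x => k (pi h x)) psi.
  (* The group element is moved first, uniformly in [psi']; then [psi'] is compared with [psi] at
     one fixed coordinate. *)
  exists ([set h' | norm_close pi (e / 2) h' h],
    [set psi' : X | `|val psi (fun x => k (pi h x)) -
                      val psi' (fun x => k (pi h x))| < e / 2]) => //=.
  move=> [h' psi'] [/= ch cpsi].
  have cact := sphere_act_close k (KX psi') (ltW e20) ch.
  have := ler_distD (val psi' (fun x => k (pi h x)))
    (val psi (fun x => k (pi h x))) (val psi' (fun x => k (pi h' x))).
  move=> /le_lt_trans; apply; rewrite [ltRHS](splitr e) ltr_leD//.
  by rewrite distrC.
pose u i (psi : X) : R := val psi (f i).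
apply: (amenable_no_drift (g := g) (u := u) G_amenable cX hX aact _ _ d0).
- by move=> i; exact: cev.
- move=> i psi; rewrite /u; apply/ler_addgt0Pr => e e0.
  have [x [x1 /(_ ord0) xe]] := sphere_approx (fun _ : 'I_1 => f i) (KX psi) e0.
  have := sphere_eval_bounded (f i) x1.
  have := ler_normD (val psi (f i) - sphere_eval x (f i)) (sphere_eval x (f i)).
  rewrite subrK; lra.
- move=> psi; apply/ler_addgt0Pr => r r0.
  (* Each of the [n] summands carries two approximation errors; [n.+1] keeps the denominator nonzero
     when [n] is 0. *)
  have e0 : 0 < r / (2 * n.+1%:R) by rewrite divr_gt0// mulr_gt0.
  pose fs (ib : 'I_n * bool) : H -> R :=
    if ib.2 then f ib.1 else fun x => f ib.1 (pi (g ib.1) x).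
  have [x [x1 xe]] := sphere_approx fs (KX psi) e0.
  apply: (le_trans (drift x x1)); rewrite -lerBlDl -sumrB.
  apply: (@le_trans _ _ (\sum_(i < n) 2 * (r / (2 * n.+1%:R)))).
    apply: ler_sum => i _.
    rewrite -[u i (act _ _)]/(val psi (fun x => f i (pi (g i) x))) /u.
    have := xe (i, true); have := xe (i, false); rewrite /fs /=.
    rewrite /sphere_eval sphere_lip_repE (asboolT (fl i)).
    move: (r / _) => e; rewrite !ltr_norml => /andP[? ?] /andP[? ?]; lra.
  have -> : 2 * (r / (2 * n.+1%:R)) = r / n.+1%:R 
    by rewrite invfM mulrCA mulVKf// pnatr_eq0.
  rewrite sumr_const card_ord -[_ *+ n]mulr_natr -mulrA ler_piMr // ?(ltW r0) //.
  by rewrite mulrC ler_pdivrMr// mul1r ler_nat.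
Qed.

End SphereMean.

(** * Exchange of test functions and finitely supported measures *)

Section Minimax.
Context {R : realType} {G : topologicalGroupType} {H : hilbertType R}.
Variable pi : unitary_rep G H.
Variables (n : nat) (g : 'I_n -> G).

Local Notation P := {ptws ('I_n * H) -> R}.

(** One test function per element [g i]. The bound is imposed at every point, even off the sphere,
    so that these tuples form a closed subset of a product of segments. *)
Definition lip_tuple (F : 'I_n * H -> R) :=
  (forall p, `|F p| <= 1) /\
  (forall i x y, rnorm x = 1 -> rnorm y = 1 -> `|F (i, x) - F (i, y)| <= rnorm (x - y)).

Definition drift (F : 'I_n * H -> R) (x : H) : R :=
  \sum_i (F (i, pi (g i) x) - F (i, x)).

Lemma lip_tuple_sphere (F : 'I_n * H -> R) i :
  lip_tuple F -> sphere_lip (fun x => F (i, x)).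
Proof. by move=> [F1 Fl]; split=> *; [exact: F1|exact: Fl]. Qed.

Lemma lip_tuple_convex (F F' : 'I_n * H -> R) (t : R) : 0 <= t <= 1 ->
  lip_tuple F -> lip_tuple F' -> lip_tuple (fun p => (1 - t) * F p + t * F' p).
Proof.
have comb (s a b c : R) : 0 <= s <= 1 -> `|a| <= c -> `|b| <= c ->
    `|(1 - s) * a + s * b| <= c.
  move=> /andP[s0 s1] ac bc; rewrite (le_trans (ler_normD _ _))// !normrM.
  rewrite (ger0_norm s0) ger0_norm ?subr_ge0//.
  have := ler_wpM2l s0 bc; have := ler_wpM2l (_ : 0 <= 1 - s) ac.
  by rewrite subr_ge0 => /(_ s1); lra.
move=> t01 [F1 Fl] [F'1 F'l]; split=> [p|i x y x1 y1]; first exact: comb.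
have := comb t _ _ _ t01 (Fl i x y x1 y1) (F'l i x y x1 y1).
by congr (`|_| <= _); ring.
Qed.

Lemma drift_bound F x : lip_tuple F -> `|drift F x| <= 2 * n%:R.
Proof.
move=> [F1 _]; rewrite (le_trans (ler_norm_sum _ _ _))//.
apply: (@le_trans _ _ (\sum_(i < n) 2)).
  apply: ler_sum => i _; rewrite (le_trans (ler_normB _ _))//.
  by have := F1 (i, pi (g i) x); have := F1 (i, x); lra.
by rewrite sumr_const card_ord -[_ *+ n]mulr_natr.
Qed.

Lemma drift_convex F F' t x :
  drift (fun p => (1 - t) * F p + t * F' p) x =
  drift F x + t * (drift F' x - drift F x).
Proof.
rewrite /drift -sumrB mulr_sumr -big_split/=; apply: eq_bigr => i _; ring.
Qed.

Let shortfall (d : R) m (x : 'I_m -> H) F : R :=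
  \sum_j Num.max 0 (d - drift F (x j)) ^+ 2.

(** A quadratic upper bound for the squared positive part, replacing its first-order expansion. *)
Let max_sqr (a b : R) : Num.max 0 (a - b) ^+ 2 <= (Num.max 0 a - b) ^+ 2.
Proof. by rewrite /Num.max /Order.max; case: ifPn => ?; case: ifPn => ?; nra. Qed.

(* Minimax: the convex function [shortfall] cannot have a positive infimum,
   since its gradient at a near-minimizer is a measure, in whose direction
   some tuple [F'] decreases it. *)
Lemma finite_drift (d : R) m (x : 'I_m -> H) : 0 < d ->
  (forall j, rnorm (x j) = 1) ->
  (forall l : 'I_m -> R, (forall j, 0 <= l j) -> \sum_j l j = 1 ->
    exists2 F, lip_tuple F & d <= \sum_j l j * drift F (x j)) ->
  exists2 F, lip_tuple F & forall j, d / 2 <= drift F (x j).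
Proof.
move=> d0 x1 sep.
pose A := [set shortfall d x F | F in lip_tuple].
have A0 : A !=set0.
  exists (shortfall d x (fun=> 0)); exists (fun=> 0) => //.
  by split=> *; rewrite ?subrr normr0 ?rnorm_ge0.
have s0 F : 0 <= shortfall d x F by apply: sumr_ge0 => j _; exact: sqr_ge0.
have lbA : has_inf A by split=> //; exists 0 => _ [F _ <-].
pose c := inf A.
(* If the infimum is below [(d / 2) ^+ 2], a near-minimizer has every single term below it, so every
   drift is at least [d / 2]. *)
have [cd|dc] := ltP c ((d / 2) ^+ 2).
  have [_ [F Fl <-] Fd] := inf_lt A0 cd.
  exists F => // j; rewrite leNgt; apply/negP => Fj.
  have : (d / 2) ^+ 2 <= Num.max 0 (d - drift F (x j)) ^+ 2.
    have d20 : 0 <= d / 2 by rewrite divr_ge0// ltW.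
    rewrite ler_sqr ?nnegrE ?le_max ?lexx//.
    by apply/orP; right; lra.
  rewrite leNgt => /negP; apply; apply: le_lt_trans Fd.
  by rewrite /shortfall (bigD1 j)//= lerDl sumr_ge0// => k _; exact: sqr_ge0.
have c0 : 0 < c by apply: lt_le_trans dc; rewrite exprn_gt0// divr_gt0.
(* Drifts are bounded by [2 * n], so differences of two of them by [4 * n]; the summand [c] makes
   [M] positive and [c / M] at most 1. *)
pose M : R := m%:R * (4 * n%:R) ^+ 2 + c.
have M0 : 0 < M by rewrite ltr_wpDl// mulr_ge0// sqr_ge0.
pose t := c / M.
have t0 : 0 < t by rewrite divr_gt0.
have t1 : t <= 1 by rewrite ler_pdivrMr// mul1r lerDr mulr_ge0// sqr_ge0.
(* Moving from [F] towards [F'] by [t] changes the shortfall by at most [- 2 * t * c + t * c];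
   starting less than [t * c] above the infimum, this lands below it. *)
have [_ [F Fl <-] Fc] := inf_adherent (mulr_gt0 t0 c0) lbA.
have cF : c <= shortfall d x F by apply: ge_inf => //; [case: lbA|exists F].
pose l j := Num.max 0 (d - drift F (x j)).
have l0 j : 0 <= l j by rewrite le_max lexx.
pose L := \sum_j l j.
have L0 : 0 < L.
  rewrite lt_def sumr_ge0// andbT; apply: contraTneq c0 => /eqP.
  rewrite psumr_eq0// => /allP l00; rewrite -leNgt (le_trans cF)//.
  rewrite /shortfall big1// => j _.
  by have /eqP := l00 j (mem_index_enum j); rewrite /l => ->; rewrite expr0n.
(* The normalized positive parts are the gradient of the shortfall up to a scalar, read as a
   probability measure. *)
have [j||F' F'l dF'] := sep (fun j => l j / L).
- by rewrite divr_ge0// ltW.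
- by rewrite -mulr_suml mulfV// gt_eqF.
have {}dF' : d * L <= \sum_j l j * drift F' (x j).
  rewrite -ler_pdivlMr// mulr_suml (le_trans dF')//.
  by apply: ler_sum => j _; rewrite mulrAC.
pose b j := drift F' (x j) - drift F (x j).
have lb : shortfall d x F <= \sum_j l j * b j.
  have -> : \sum_j l j * b j = \sum_j l j * drift F' (x j) - \sum_j l j * drift F (x j).
    by rewrite -sumrB; apply: eq_bigr => j _; rewrite mulrBr.
  have -> : \sum_j l j * drift F (x j) = d * L - shortfall d x F.
    rewrite /L mulr_sumr -sumrB; apply: eq_bigr => j _; rewrite /l /Num.max /Order.max.
    by case: ifPn => _; ring.
  lra.
have bM : \sum_j b j ^+ 2 <= M.
  apply: (@le_trans _ _ (m%:R * (4 * n%:R) ^+ 2)); last by rewrite lerDl ltW.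
  apply: (@le_trans _ _ (\sum_(j < m) (4 * n%:R) ^+ 2)); last first.
    by rewrite sumr_const card_ord -[_ *+ m]mulr_natl.
  apply: ler_sum => j _.
  rewrite -real_normK ?num_real// ler_sqr ?nnegrE ?mulr_ge0//.
  rewrite (le_trans (ler_normB _ _))//.
  by have := drift_bound (x j) Fl; have := drift_bound (x j) F'l; lra.
pose Ft p := (1 - t) * F p + t * F' p.
have Ftl : lip_tuple Ft by apply: lip_tuple_convex => //; rewrite ltW.
have : c <= shortfall d x Ft by apply: ge_inf => //; [case: lbA|exists Ft].
have : shortfall d x Ft <= shortfall d x F - 2 * t * \sum_j l j * b j +
    t ^+ 2 * \sum_j b j ^+ 2.
  rewrite /shortfall !mulr_sumr -sumrB -big_split/=; apply: ler_sum => j _.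
  rewrite drift_convex opprD addrA (le_trans (max_sqr _ _))// -/(l j) -/(b j).
  by rewrite le_eqVlt; apply/orP; left; apply/eqP; ring.
have : t ^+ 2 * \sum_j b j ^+ 2 <= t * c.
  rewrite expr2 -mulrA ler_wpM2l ?(ltW t0)// /t mulrAC ler_pdivrMr//.
  by rewrite ler_wpM2l// (ltW c0).
have : t * c <= t * \sum_j l j * b j by rewrite ler_wpM2l ?(ltW t0)// (le_trans cF).
lra.
Qed.

End Minimax.

(** * Finitely supported almost invariant measures *)

Section AlmostInvariantMeasures.
Context {R : realType} {G : topologicalGroupType} {H : hilbertType R}.
Variable pi : unitary_rep G H.
Variables (n : nat) (g : 'I_n -> G).

Local Notation P := {ptws ('I_n * H) -> R}.
Local Notation drift := (drift pi g).

Let eval_continuous (p : 'I_n * H) : continuous (fun F : P => F p).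
Proof. exact: (@proj_continuous _ (fun _ : 'I_n * H => R) p). Qed.

Let evalB_continuous (p q : 'I_n * H) : continuous (fun F : P => F p - F q).
Proof.
move=> F; have cp := @eval_continuous p F; have cq := @eval_continuous q F.
exact: cvgB cp cq.
Qed.

Lemma drift_continuous x : continuous (fun F : P => drift F x).
Proof.
have ac : continuous (fun z : R * R => z.1 + z.2) by exact: add_continuous.
have c i : continuous (fun F : P => F (i, pi (g i) x) - F (i, x)).
  exact: evalB_continuous.
exact: (@continuous_big _ _ _ 0 xpredT ac P (index_enum 'I_n) _ (fun i _ => c i)).
Qed.

Let closed_le_continuous (u : P -> R) (c : R) :
  continuous u -> closed [set F | u F <= c].
Proof.
move=> /continuous_closedP cu.
exact: (cu [set r : R | r <= c] (@closed_le _ c)).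
Qed.

Lemma lip_tuple_compact : compact (@lip_tuple R H n : set P).
Proof.
have cB : compact [set F : P | forall p, (`[(-1 : R), 1]%classic : set R) (F p)].
  apply: (@tychonoff _ (fun=> R) (fun=> `[(-1 : R), 1]%classic)) => p.
  exact: segment_compact.
apply: subclosed_compact cB _; last first.
  by move=> F [F1 _] p; rewrite /= in_itv/= -ler_norml.
have nc (u : P -> R) : continuous u -> continuous (fun F => `|u F|).
  by move=> cu F; have cF := cu F; exact: cvg_norm cF.
rewrite (_ : (@lip_tuple R H n : set P) =
  \bigcap_(p in [set: 'I_n * H]) [set F : P | `|F p| <= 1] `&`
  \bigcap_(q in [set q : 'I_n * H * H | rnorm q.1.2 = 1 /\ rnorm q.2 = 1])
    [set F : P | `|F q.1 - F (q.1.1, q.2)| <= rnorm (q.1.2 - q.2)]).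
  apply: closedI; apply: closed_bigI => p _; apply: closed_le_continuous.
    by apply: nc; exact: eval_continuous.
  by apply: nc; exact: evalB_continuous.
apply/seteqP; split=> [F [F1 Fl]|F [F1 Fl]].
  by split=> [p _|[[i x] y] /= [x1 y1]]; [exact: F1|exact: Fl].
by split=> [p|i x y x1 y1]; [exact: F1|exact: (Fl (i, x, y))].
Qed.

Hypothesis G_amenable : amenable R G.
Hypothesis pic : norm_continuous_rep pi.
Hypothesis H1 : exists x : H, rnorm x = 1.

(** By contradiction: if every finitely supported measure is detected by some tuple, [finite_drift]
    yields one tuple drifting on any given finite set, compactness one drifting on the whole sphere,
    and [no_sphere_drift] excludes it. *)
Lemma almost_invariant_measure (d : R) : 0 < d ->
  exists m (x : 'I_m -> H) (l : 'I_m -> R),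
    [/\ forall j, rnorm (x j) = 1, forall j, 0 <= l j, \sum_j l j = 1 &
        forall i f, sphere_lip f ->
          `|\sum_j l j * (f (pi (g i) (x j)) - f (x j))| <= d].
Proof.
move=> d0; apply: contrapT => none.
have sep m (x : 'I_m -> H) : (forall j, rnorm (x j) = 1) ->
    forall l : 'I_m -> R, (forall j, 0 <= l j) -> \sum_j l j = 1 ->
    exists2 F, lip_tuple F & d <= \sum_j l j * drift F (x j).
  move=> x1 l l0 l1; apply: contrapT => noF; apply: none.
  exists m, x, l; split=> // i f [f1 fl]; rewrite leNgt; apply/negP => df.
  apply: noF.
  pose s := Num.sg (\sum_j l j * (f (pi (g i) (x j)) - f (x j))).
  have s1 : `|s| <= 1 by rewrite normr_sg; case: (_ == _).
  (* The offending function, with the sign that makes its drift positive, sits in slot [i]; it is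
     cut to 0 off the sphere, where [f] is uncontrolled. *)
  pose F (p : 'I_n * H) := (p.1 == i)%:R * (if rnorm p.2 == 1 then s * f p.2 else 0).
  exists F.
    split=> [[k y]|k y z y1 z1]; rewrite /F /=; case: eqP => _;
      rewrite ?mul0r ?mul1r ?subrr ?normr0 ?rnorm_ge0//.
      case: eqP => y1; rewrite ?normr0// normrM -[leRHS]mulr1.
      by rewrite ler_pM// f1.
    rewrite y1 z1 eqxx -mulrBr normrM (le_trans _ (fl _ _ y1 z1))//.
    by rewrite ler_piMl.
  rewrite (le_trans (ltW df))// normrEsg -/s mulr_sumr; apply: ler_sum => j _.
  have -> : drift F (x j) = s * (f (pi (g i) (x j)) - f (x j)).
    rewrite /drift (bigD1 i)//= big1 ?addr0 => [|k /negbTE ki].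
      by rewrite /F /= eqxx !mul1r rep_rnorm x1 eqxx mulrBr.
    by rewrite /F /= ki !mul0r subrr.
  by rewrite mulrCA.
(* Tuples drifting on a finite set: these sets are directed by concatenation, and a cluster point
   drifts everywhere. *)
pose B (s : seq H) : set P := [set F | lip_tuple F /\
  forall x, x \in s -> rnorm x = 1 -> d / 2 <= drift F x].
have B0 s : B s !=set0.
  pose t := [seq x <- s | rnorm x == 1].
  have t1 (j : 'I_(size t)) : rnorm (tnth (in_tuple t) j) = 1.
    by have := mem_tnth j (in_tuple t); rewrite mem_filter => /andP[/eqP].
  have [F Fl Fd] := finite_drift d0 t1 (sep _ _ t1).
  exists F; split=> // x xs x1.
  have xt : x \in in_tuple t by rewrite mem_filter x1 eqxx.
  by have /tnthP[j ->] := xt; exact: Fd.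
have FB : ProperFilter (filter_from [set: seq H] B).
  apply: filter_from_proper => [|s _]; last exact: B0.
  apply: filter_from_filter; first by exists [::].
  move=> s t _ _; exists (s ++ t) => // F [Fl Fd].
  by split; split=> // x xs; apply: Fd; rewrite mem_cat xs ?orbT.
have [|F [Fl clF]] := lip_tuple_compact FB.
  by exists [::] => // F [].
apply: (@no_sphere_drift _ _ _ pi G_amenable pic n g (fun i x => F (i, x)) (d / 2)) => //.
- by move=> i; exact: lip_tuple_sphere.
- by rewrite divr_gt0.
move=> x x1; rewrite -/(drift F x).
have cl : closed [set F' : P | d / 2 <= drift F' x].
  have /continuous_closedP c := @drift_continuous x.
  exact: (c [set r : R | d / 2 <= r] (@closed_ge _ (d / 2))).
apply: cl => C FC; apply: clF => //; exists [:: x] => // F' [_]; apply => //.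
by rewrite mem_head.
Qed.

End AlmostInvariantMeasures.

(** * The Powers-Stormer inequality *)

Section PowersStormer.
Context {R : realType} {H : hilbertType R}.
Implicit Types x y : H.

Local Notation orthonormal := (@orthonormal_family R H _).
Local Notation orthogonal v := (forall i j, i != j -> inner (v i) (v j) = 0).

Lemma unitary_trace n (P : 'M[R[i]]_n) (M : 'I_n -> 'I_n -> R[i]) :
  P \is unitarymx ->
  \sum_k \sum_i \sum_j P k i * (P k j)^* * M i j = \sum_i M i i.
Proof.
move=> /unitarymxP PP; have {}PP := mulmx1C PP.
rewrite exchange_big/=; apply: eq_bigr => i _; rewrite exchange_big/=.
rewrite (bigD1 i)//= [X in _ + X]big1 ?addr0 => [|j ji]; rewrite -mulr_suml.
  rewrite [X in X * _](_ : _ = 1) ?mul1r//.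
  transitivity ((P^t* *m P)%sesqui i i); last by rewrite PP mxE eqxx.
  by rewrite mxE; apply: eq_bigr => k _; rewrite !mxE mulrC.
rewrite [X in X * _](_ : _ = 0) ?mul0r//.
transitivity ((P^t* *m P)%sesqui j i); last by rewrite PP mxE (negbTE ji).
by rewrite mxE; apply: eq_bigr => k _; rewrite !mxE mulrC.
Qed.

Lemma unitary_comb_rnorm2 n (P : 'M[R[i]]_n) (x : 'I_n -> H) :
  P \is unitarymx ->
  \sum_k rnorm (unitary_comb P x k) ^+ 2 = \sum_j rnorm (x j) ^+ 2.
Proof.
move=> Pu; apply: complexI; rewrite !rmorph_sum/=.
under eq_bigr do rewrite -inner_sqr inner_unitary_comb.
by rewrite unitary_trace//; apply: eq_bigr => i _; rewrite inner_sqr.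
Qed.

(** Both sides are the quadratic form at [y] of the sum of the rank one operators of the family,
    which a unitary change of family preserves. *)
Lemma unitary_comb_inner2 n (P : 'M[R[i]]_n) (x : 'I_n -> H) y :
  P \is unitarymx ->
  \sum_k rnorm (inner (unitary_comb P x k) y) ^+ 2 =
  \sum_j rnorm (inner (x j) y) ^+ 2.
Proof.
move=> Pu; apply: complexI; rewrite !rmorph_sum/=.
under eq_bigr do rewrite sqr_rnormE.
under [RHS]eq_bigr do rewrite sqr_rnormE.
rewrite -(unitary_trace (fun i j => inner (x i) y * (inner (x j) y)^*) Pu).
apply: eq_bigr => k _; rewrite inner_suml mulr_suml; apply: eq_bigr => i _.
rewrite rmorph_sum mulr_sumr; apply: eq_bigr => j _.
by rewrite !innerZl rmorphM/=; ring.
Qed.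

Lemma unitary_comb_orthonormal n (P : 'M[R[i]]_n) (e : 'I_n -> H) :
  P \is unitarymx -> orthonormal e -> orthonormal (unitary_comb P e).
Proof.
move=> /unitarymxP PP oe k l; rewrite inner_unitary_comb.
transitivity ((P *m P^t*)%sesqui k l); last by rewrite PP mxE.
rewrite mxE; apply: eq_bigr => i _; rewrite (bigD1 i)//= big1 => [|j ji].
  by rewrite oe eqxx mulr1 addr0 !mxE.
by rewrite oe eq_sym (negbTE ji) mulr0.
Qed.

Lemma unitary_comb_spanned n (P : 'M[R[i]]_n) (e : 'I_n -> H) x :
  P \is unitarymx -> orthonormal e -> spanned e x ->
  spanned (unitary_comb P e) x.
Proof.
move=> Pu oe; apply: spanned_trans => j.
rewrite (unitary_comb_inv e j Pu); apply: spanned_comb => k.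
exact: (spanned_family k (unitary_comb_orthonormal Pu oe)).
Qed.

Section Projection.
Variables (N : nat) (f : 'I_N -> H).
Hypothesis off : orthonormal f.

Definition span_proj x := \sum_a inner x (f a) *: f a.

Lemma span_proj_linear : linear span_proj.
Proof.
move=> a x y; rewrite /span_proj scaler_sumr -big_split/=.
by apply: eq_bigr => i _; rewrite innerDl innerZl scalerDl scalerA.
Qed.

Lemma span_proj_le x : rnorm (span_proj x) <= 1 * rnorm x.
Proof.
rewrite mul1r -ler_sqr ?nnegrE ?rnorm_ge0// orthonormal_rnorm2_sum//.
exact: bessel.
Qed.

Lemma spanned_span_proj x : spanned f (span_proj x).
Proof. by apply: spanned_comb => a; exact: spanned_family. Qed.

Lemma inner_span_proj x y : spanned f y -> inner (span_proj x) y = inner x y.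
Proof.
move=> fy; rewrite {2}fy inner_suml inner_sumr; apply: eq_bigr => a _.
by rewrite innerZl innerZr mulrC -innerC.
Qed.

(** Applies [sum_comp_le] to the projection onto the span: an operator factoring through it is
    measured by the single family [f]. *)
Lemma hs2_span (S : {linear H -> H}) : (forall x, S (span_proj x) = S x) ->
  hs_bounded S /\ hs2 S = hs_on f S.
Proof.
move=> Sf; have le n (e : 'I_n -> H) : orthonormal e -> hs_on e S <= hs_on f S.
  move=> oe; pose A := linear_of span_proj_linear.
  have := sum_comp_le S oe off (A := A) (fun i => spanned_span_proj (e i)) span_proj_le.
  rewrite expr1n mul1r; apply: le_trans.
  by rewrite /hs_on; under [leRHS]eq_bigr do rewrite /= Sf.
have Sb : hs_bounded S by exists (hs_on f S).
by split=> //; apply/eqP; rewrite eq_le hs2_le//= hs2_ub.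
Qed.

End Projection.

Section SquareRoot.
Variables (m : nat) (v : 'I_m -> H).

(* The square root of [x |-> \sum_k inner x (v k) *: v k] when the [v k] are
   pairwise orthogonal (vanishing ones contribute nothing as 0^-1 = 0). *)
Definition root_op x := \sum_k ((rnorm (v k))^-1%:C * inner x (v k)) *: v k.

Lemma root_op_linear : linear root_op.
Proof.
move=> a x y; rewrite /root_op scaler_sumr -big_split/=.
apply: eq_bigr => k _; rewrite innerDl innerZl scalerA -scalerDl.
by congr (_ *: _); ring.
Qed.

Lemma root_op_sym x y : inner (root_op x) y = inner x (root_op y).
Proof.
rewrite inner_suml inner_sumr; apply: eq_bigr => k _.
rewrite innerZl innerZr rmorphM/= conj_real -innerC; ring.
Qed.

Lemma root_op_ge0 x : exists2 r : R, 0 <= r & inner (root_op x) x = r%:C.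
Proof.
exists (\sum_k (rnorm (v k))^-1 * rnorm (inner x (v k)) ^+ 2).
  by apply: sumr_ge0 => k _; rewrite mulr_ge0 ?invr_ge0 ?rnorm_ge0 ?sqr_ge0.
rewrite inner_suml rmorph_sum; apply: eq_bigr => k _.
by rewrite innerZl [RHS]rmorphM/= sqr_rnormE (innerC (v k)) mulrA.
Qed.

Lemma root_op_spanned N (f : 'I_N -> H) x :
  (forall k, spanned f (v k)) -> spanned f (root_op x).
Proof. by move=> fv; apply: spanned_comb. Qed.

Lemma root_op_proj N (f : 'I_N -> H) x : (forall k, spanned f (v k)) ->
  root_op (span_proj f x) = root_op x.
Proof.
by move=> fv; apply: eq_bigr => k _; rewrite inner_span_proj.
Qed.

(** The identity [|T^(1/2) x|^2 = <T x, x>] for [T] the sum of the rank one operators of [v]. *)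
Lemma root_op_rnorm2 x : orthogonal v ->
  rnorm (root_op x) ^+ 2 = \sum_k rnorm (inner (v k) x) ^+ 2.
Proof.
move=> ov; rewrite rnorm2_sum//; apply: eq_bigr => k _.
rewrite (innerC (v k)) rnormJ rnormM rnormC.
rewrite ger0_norm ?invr_ge0 ?rnorm_ge0//.
have [vk|vk] := eqVneq (v k) 0; first by rewrite vk inner0r !rnorm0 mulr0 expr0n mul0r.
by rewrite exprMn exprVn mulrAC mulVf ?mul1r// expf_neq0// rnorm_eq0.
Qed.

End SquareRoot.

End PowersStormer.

Section PowersStormerInequality.
Context {R : realType} {H : hilbertType R}.
Implicit Types x y : H.
Local Notation orthonormal := (@orthonormal_family R H _).
Local Notation orthogonal v := (forall i j, i != j -> inner (v i) (v j) = 0).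

Definition root_lin m (v : 'I_m -> H) : {linear H -> H} :=
  linear_of (root_op_linear v).

Lemma diagonalize N (f : 'I_N -> H) (D : {linear H -> H}) :
  orthonormal f -> (forall x y, inner (D x) y = inner x (D y)) ->
  (forall x, spanned f (D x)) -> exists e : 'I_N -> H, [/\ orthonormal e,
    forall x, spanned f x -> spanned e x &
    forall a, D (e a) = inner (D (e a)) (e a) *: e a].
Proof.
move=> off Dsym Df; pose M : 'M[R[i]]_N := \matrix_(i, j) inner (D (f i)) (f j).
have [P [Pu PM]] : exists P : 'M[R[i]]_N, P \is unitarymx /\
    forall k l, k != l -> \sum_i \sum_j P k i * (P l j)^* * M i j = 0.
  by apply: hermitian_diagonalization => i j; rewrite !mxE innerC Dsym.
have oe := unitary_comb_orthonormal Pu off.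
have fe x : spanned f x -> spanned (unitary_comb P f) x.
  exact: unitary_comb_spanned.
exists (unitary_comb P f); split=> // a.
rewrite {1}(fe _ (Df (unitary_comb P f a))) (bigD1 a)//= big1 ?addr0// => b ba.
rewrite (_ : inner _ _ = 0) ?scale0r//.
have -> : D (unitary_comb P f a) = unitary_comb P (D \o f) a.
  by rewrite linear_sum; apply: eq_bigr => j _; rewrite linearZ.
rewrite inner_unitary_comb -[RHS](PM a b) 1?eq_sym//.
by apply: eq_bigr => i _; apply: eq_bigr => j _; rewrite mxE.
Qed.

Let real_complex_expand (b l c : R) :
  (b + 2 * l * c + l ^+ 2)%:C = b%:C + 2 * l%:C * c%:C + l%:C ^+ 2.
Proof. by rewrite -rmorphXn !rmorphD !rmorphM/= rmorph_nat. Qed.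

(* In an eigenbasis of [A - B] the eigenvalues [lam] satisfy
   [|lam| <= <A e, e> + <B e, e>] and
   [<(A^2 - B^2) e, e> = lam (<A e, e> + <B e, e>)]. *)
Lemma powers_stormer m (u v : 'I_m -> H) : orthogonal u -> orthogonal v ->
  exists N (e : 'I_N -> H) (s : 'I_N -> R), [/\ orthonormal e,
    forall a, `|s a| <= 1 &
    hs2 (root_lin u \- root_lin v) <=
    \sum_a s a * (\sum_k rnorm (inner (u k) (e a)) ^+ 2 -
                  \sum_k rnorm (inner (v k) (e a)) ^+ 2)].
Proof.
move=> ou ov.
have [N [f [off fuv]]] := orthonormal_basis_fin
  (fun k : 'I_m + 'I_m => match k with inl i => u i | inr i => v i end).
have fu k : spanned f (u k) by exact: (fuv (inl k)).
have fv k : spanned f (v k) by exact: (fuv (inr k)).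
pose D : {linear H -> H} := linear_of (linearP (root_lin u \- root_lin v)).
have DE x : D x = root_op u x - root_op v x by [].
have Dsym x y : inner (D x) y = inner x (D y).
  by rewrite !DE innerBl innerBr !root_op_sym.
have Df x : spanned f (D x).
  rewrite DE /spanned {1}(root_op_spanned x fu) {1}(root_op_spanned x fv) -sumrB.
  by apply: eq_bigr => a _; rewrite innerBl scalerBl.
have [e [oe fe De]] := diagonalize off Dsym Df.
pose lam a := complex.Re (inner (D (e a)) (e a)).
(* These signs describe the contraction [sgn (A - B)], paired with [A^2 - B^2] on the right-hand
   side. *)
pose s a := Num.sg (lam a).
exists N, e, s; split=> // [a|]; first by rewrite normr_sg; case: (_ == _).
have Dproj x : D (span_proj e x) = D x.
  by rewrite !DE !root_op_proj// => k; apply: fe.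
have [_ ->] := hs2_span oe Dproj.
apply: ler_sum => a _.
have [al al0 alE] := root_op_ge0 u (e a).
have [be be0 beE] := root_op_ge0 v (e a).
have lamE : inner (D (e a)) (e a) = (lam a)%:C.
  by rewrite /lam DE innerBl alE beE -rmorphB.
have lam_ab : lam a = al - be.
  by apply: complexI; rewrite -lamE DE innerBl alE beE -rmorphB.
have Ae : root_op u (e a) = root_op v (e a) + (lam a)%:C *: e a.
  by rewrite -lamE -De DE addrC subrK.
have gam : rnorm (root_op u (e a)) ^+ 2 =
    rnorm (root_op v (e a)) ^+ 2 + 2 * lam a * be + lam a ^+ 2.
  apply: complexI; rewrite -inner_sqr Ae !innerDl !innerDr !innerZl !innerZr.
  rewrite conj_real beE (innerC (e a)) beE conj_real oe eqxx inner_sqr.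
  rewrite real_complex_expand mulr1; move: (_ ^+ 2)%:C (be%:C) (lam a)%:C => p q r; ring.
rewrite De lamE rnormZ rnormC (orthonormal_rnorm _ oe) mulr1 real_normK ?num_real//.
rewrite -!root_op_rnorm2// gam /s.
have -> : lam a ^+ 2 = `|lam a| ^+ 2 by rewrite real_normK ?num_real.
(* Positivity of both square roots enters here: [|al - be| <= al + be]. *)
have lam_le : `|lam a| <= al + be.
  by rewrite lam_ab ler_norml; apply/andP; split; lra.
have -> : Num.sg (lam a) * (rnorm (root_op v (e a)) ^+ 2 + 2 * lam a * be +
   `|lam a| ^+ 2 - rnorm (root_op v (e a)) ^+ 2) = `|lam a| * (al + be).
  rewrite real_normK ?num_real// normrEsg.
  by rewrite (_ : al = lam a + be); [ring|rewrite lam_ab subrK].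
by rewrite expr2 ler_wpM2l.
Qed.

(** The quadratic form of a contraction has Lipschitz constant 2 on the sphere, whence the
    normalization by [2^-1]. *)
Lemma sign_form_lip N (e : 'I_N -> H) (s : 'I_N -> R) :
  orthonormal e -> (forall a, `|s a| <= 1) ->
  sphere_lip (fun x => 2^-1 * \sum_a s a * rnorm (inner x (e a)) ^+ 2).
Proof.
move=> oe s1; split=> [x x1|x y x1 y1].
  rewrite normrM ger0_norm ?invr_ge0// (@le_trans _ _ (2^-1 * 1))//; last by lra.
  rewrite ler_pM2l ?invr_gt0// (le_trans (ler_norm_sum _ _ _))//.
  have := bessel x oe; rewrite x1 expr1n; apply: le_trans; apply: ler_sum => a _.
  by rewrite normrM [X in _ * X]ger0_norm ?sqr_ge0// ler_piMl ?sqr_ge0.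
have [->|xy] := eqVneq x y; first by rewrite !subrr normr0 rnorm0.
have r0 : 0 < rnorm (x - y) by rewrite rnorm_gt0 subr_eq0.
set r := rnorm (x - y) in r0 *.
rewrite -mulrBr -sumrB normrM ger0_norm ?invr_ge0// mulrC ler_pdivrMr//.
rewrite (le_trans (ler_norm_sum _ _ _))//.
(* Termwise arithmetic-geometric mean with weight [r]: after summation Bessel bounds the two parts
   by [r] each. *)
apply: (@le_trans _ _ (\sum_a (r^-1 * rnorm (inner (x - y) (e a)) ^+ 2 +
   r / 2 * (rnorm (inner x (e a)) ^+ 2 + rnorm (inner y (e a)) ^+ 2)))).
  apply: ler_sum => a _; rewrite -mulrBr normrM.
  set p := rnorm (inner x _); set q := rnorm (inner y _).
  have p0 : 0 <= p by exact: rnorm_ge0.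
  have q0 : 0 <= q by exact: rnorm_ge0.
  rewrite innerBl; set w := rnorm (_ - _).
  have pq : `|p - q| <= w.
    have := ler_rdist (inner x (e a)) (inner y (e a)).
    have := ler_rdist (inner y (e a)) (inner x (e a)).
    by rewrite rdistC -/p -/q -/w ler_norml => ? ?; apply/andP; split; lra.
  have w0 : 0 <= w by exact: rnorm_ge0.
  apply: (@le_trans _ _ (w * (p + q))).
    rewrite -[leRHS]mul1r ler_pM// subr_sqr normrM [X in _ * X]ger0_norm ?addr_ge0//.
    by rewrite ler_wpM2r// addr_ge0.
  have : 0 <= r * (w / r - (p + q) / 2) ^+ 2 by rewrite mulr_ge0 ?sqr_ge0// ltW.
  rewrite (_ : r * _ ^+ 2 = r^-1 * w ^+ 2 - w * (p + q) + r / 4 * (p + q) ^+ 2).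
    have : 0 <= r / 4 * (p - q) ^+ 2 by rewrite mulr_ge0 ?sqr_ge0// ltW// divr_gt0.
    by move: (r^-1 * _) => c; lra.
  by field; rewrite gt_eqF.
rewrite big_split/= -!mulr_sumr big_split/=.
have := bessel (x - y) oe; have := bessel x oe; have := bessel y oe.
rewrite x1 y1 expr1n -/r => ye xe.
have ri0 : 0 <= r^-1 by rewrite invr_ge0 ltW.
move=> /(ler_wpM2l ri0); rewrite expr2 mulKf ?gt_eqF// => le1.
have : r / 2 * (\sum_a rnorm (inner x (e a)) ^+ 2 +
    \sum_a rnorm (inner y (e a)) ^+ 2) <= r / 2 * 2.
  by rewrite ler_wpM2l ?divr_ge0 ?(ltW r0)//; lra.
by move=> le2; apply: le_trans (lerD le1 le2) _; lra.
Qed.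

End PowersStormerInequality.

(** * Maximal almost periodicity *)

Section AlmostInvariantOperators.
Context {R : realType} {G : topologicalGroupType} {H : hilbertType R}.
Variable pi : unitary_rep G H.
Local Notation orthogonal v := (forall i j, i != j -> inner (v i) (v j) = 0).
Local Notation HS := (@hs_space R H).

(** The squared Hilbert-Schmidt norm of a square root is the trace of the operator. *)
Lemma root_op_hs2 m (v : 'I_m -> H) : orthogonal v ->
  hs_mem (root_op v) /\ hs2 (root_op v) = \sum_k rnorm (v k) ^+ 2.
Proof.
move=> ov; have [N [f [off fv]]] := orthonormal_basis v.
have [|bd E] := @hs2_span R H N f off (root_lin v).
  by move=> x; exact: root_op_proj.
split; first by split=> //; exact: root_op_linear.
rewrite [LHS]E /hs_on.
under eq_bigr do rewrite [root_lin v _]/(root_op v _) root_op_rnorm2//.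
by rewrite exchange_big/=; apply: eq_bigr => k _; rewrite (parseval off (fv k)).
Qed.

Lemma conj_root_op m (v : 'I_m -> H) g x :
  pi g (root_op v (pi g^-1%g x)) = root_op (fun k => pi g (v k)) x.
Proof.
rewrite linear_sum; apply: eq_bigr => k _.
by rewrite linearZ/= rep_rnorm inner_repl invgK.
Qed.

(** With the weights absorbed as square roots in [xi], the density operator of the measure is the
    sum of the rank one operators of [xi]. The orthogonal family [eta] gives the same operator, so
    [root_op eta] is its square root. The factor 2 undoes the normalization in [sign_form_lip]. *)
Lemma weighted_root m (x : 'I_m -> H) (l : 'I_m -> R) :
  (forall j, rnorm (x j) = 1) -> (forall j, 0 <= l j) -> \sum_j l j = 1 ->
  exists S : HS, rnorm S = 1 /\ forall g (d : R),
    (forall f, sphere_lip f ->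
      `|\sum_j l j * (f (pi g (x j)) - f (x j))| <= d) ->
    rnorm (conj_rep pi g S - S) ^+ 2 <= 2 * d.
Proof.
move=> x1 l0 l1; pose xi j := (Num.sqrt (l j))%:C *: x j.
have [P [Pu oP]] := orthogonalization xi.
pose eta := unitary_comb P xi.
have oeta : orthogonal eta by exact: oP.
have [Sm SE] := root_op_hs2 oeta.
have xi2 y (T : {linear H -> H}) j :
    rnorm (inner (T (xi j)) y) ^+ 2 = l j * rnorm (inner (T (x j)) y) ^+ 2.
  rewrite linearZ innerZl rnormM rnormC exprMn ger0_norm ?sqrtr_ge0//.
  by rewrite sqr_sqrtr.
pose S : HS := hs_op_of Sm.
exists S; split.
  apply/eqP; rewrite -(@eqrXn2 _ 2%N) ?rnorm_ge0// hs_space_rnorm expr1n.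
  rewrite [hs2 _]SE unitary_comb_rnorm2// -l1; apply/eqP; apply: eq_bigr => j _.
  by rewrite rnormZ rnormC x1 mulr1 real_normK ?num_real// sqr_sqrtr.
move=> g d gd.
have ogeta : orthogonal (fun k => pi g (eta k)).
  by move=> k k' kk'; rewrite rep_inner oeta.
have [N [e [s [oe s1]]]] := powers_stormer ogeta oeta.
rewrite hs_space_rnorm.
rewrite (_ : root_lin _ \- root_lin eta = hs_lin (conj_rep pi g S - S)); last first.
  apply/funext => y; rewrite hs_linB.
  rewrite -[hs_lin (conj_rep _ _ _) y]/(pi g (root_op eta (pi g^-1%g y))).
  by rewrite conj_root_op.
move=> /le_trans; apply.
have := gd _ (sign_form_lip oe s1).
under eq_bigr do rewrite -mulrBr mulrCA.
rewrite -mulr_sumr normrM ger0_norm ?invr_ge0// ler_pdivrMl// mulrC.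
move=> /(le_trans (ler_norm _)).
rewrite [X in X <= _](_ : _ = \sum_a s a *
    (\sum_k rnorm (inner (pi g (eta k)) (e a)) ^+ 2 -
     \sum_k rnorm (inner (eta k) (e a)) ^+ 2)).
  by rewrite mulrC.
under eq_bigr do rewrite -sumrB mulr_sumr.
rewrite exchange_big/=; apply: eq_bigr => a _.
rewrite (unitary_comb_inner2 xi (e a) Pu).
under [X in _ * (X - _)]eq_bigr => k _.
  rewrite linear_sum (eq_bigr (fun j => P k j *: pi g (xi j))); last first.
    by move=> j _; rewrite linearZ.
  over.
rewrite (unitary_comb_inner2 (fun j => pi g (xi j)) (e a) Pu) -sumrB mulr_sumr.
apply: eq_bigr => j _; rewrite xi2 (xi2 _ idfun) /=; ring.
Qed.

Hypothesis G_amenable : amenable R G.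
Hypothesis pic : norm_continuous_rep pi.

Lemma conj_rep_almost_invariant : (exists x : H, rnorm x = 1) ->
  almost_invariant_vectors (conj_rep pi).
Proof.
move=> H1 e K e0 cK.
(* Conjugation doubles the mesh [e / 8] of the finite net, and [e / 4] is left for almost invariance
   on the net. *)
have e80 : 0 < e / 8 by rewrite divr_gt0.
have e_lt : e / 4 + 2 * (e / 8) < e by lra.
have [s Ks] : exists s : seq G, forall g, K g ->
    exists2 h, h \in s & norm_close pi (e / 8) g h.
  pose T : ptopologicalType := HB.pack (TopologicalGroup.sort G)
    (isPointed.Build (TopologicalGroup.sort G) 1%g).
  have ccK : @cover_compact T K by rewrite -compact_cover.
  have := ccK G setT (fun h => interior [set g | norm_close pi (e / 8) g h]).
  case=> [h _|g Kg|D _ DK]; first exact: open_interior.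
    by exists g => //; have /norm_continuousP := pic; apply.
  exists (finmap.enum_fset D) => g /DK[h hD gh]; exists h => //.
  exact: interior_subset gh.
(* Chosen so that the bound [2 * d] of [weighted_root] is the square of [e / 4]. *)
have d0 : 0 < (e / 4) ^+ 2 / 2 by rewrite divr_gt0// exprn_gt0// divr_gt0.
have [m [x [l [x1 l0 l1 xl]]]] :=
  almost_invariant_measure (tnth (in_tuple s)) G_amenable pic H1 d0.
have [S [S1 Sg]] := weighted_root x1 l0 l1.
exists S; split; first by rewrite rnormE S1.
move=> g /Ks[h hs gh]; rewrite -/(rnorm _).
have /tnthP[i hE] : h \in in_tuple s by [].
have := Sg _ _ (xl i); rewrite -hE.
rewrite mulrC divfK ?pnatr_eq0// ler_sqr ?nnegrE ?rnorm_ge0 ?divr_ge0 ?(ltW e0)// => hS.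
have gS := norm_close_conj (ltW e80) gh S; rewrite S1 mulr1 in gS.
apply: le_lt_trans (ler_rdistD (conj_rep pi h S) S (conj_rep pi g S)) _.
apply: (@le_lt_trans _ _ (e / 4 + 2 * (e / 8))); last exact: e_lt.
by apply: lerD; rewrite rdistC.
Qed.

End AlmostInvariantOperators.

(** * Existence of finite-dimensional subrepresentations *)

Section FiniteDimensionalSubrepresentation.
Context {R : realType} {G : topologicalGroupType}.
Hypothesis G_amenable : amenable R G.
Hypothesis G_T : property_T R G.

Lemma finite_dim_subrepresentation (H : hilbertType R) (pi : unitary_rep G H) :
  norm_continuous_rep pi -> (exists x : H, x != 0) ->
  exists (V : hilbertType R) (rho : unitary_rep G V) (J : {linear V -> H}),
    [/\ isometric_intertwiner rho pi J, finite_dimensional V &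
        exists v : V, v != 0].
Proof.
move=> pic [x x0].
have H1 : exists y : H, rnorm y = 1.
  by exists ((rnorm x)^-1%:C *: x); exact: rnorm_normalize.
have [S [S1 Sinv]] := G_T
  (norm_strongly_continuous (conj_rep_norm_continuous pic))
  (conj_rep_almost_invariant G_amenable pic H1).
apply: (@commutant_subrepresentation R H (hs_lin S) (hs_op_bounded S)).
  apply: contrapT => S0; have : `|S| != 0 by rewrite S1 oner_eq0.
  rewrite normr_eq0 => /negP; apply; apply/eqP; apply: hs_op_eq0 => y.
  by apply/eqP/negPn/negP => Sy; apply: S0; exists y.
(* Invariance under conjugation, evaluated at [pi g y], is commutation with [pi g]. *)
move=> g y; have /(congr1 (fun T => hs_lin T (pi g y))) := Sinv g.
by rewrite -[LHS]/(pi g (hs_lin S (pi g^-1%g (pi g y)))) repK => <-.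
Qed.

End FiniteDimensionalSubrepresentation.

Theorem theorem6p3 (R : realType) (G : topologicalGroupType)
    (G_hausdorff : hausdorff_space G)
    (G_rep : exists (H : hilbertType R) (pi : unitary_rep G H),
      norm_continuous_rep pi /\ faithful_rep pi)
    (G_amenable : amenable R G)
    (G_T : property_T R G) :
  maximally_almost_periodic R G.
Proof.
move=> g h gh; apply: contrapT => nosep; apply: gh.
have {}nosep (V : hilbertType R) (rho : unitary_rep G V) :
    finite_dimensional V -> norm_continuous_rep rho ->
    forall x, rho g x = rho h x.
  move=> fV rc x; apply: contrapT => gx; apply: nosep.
  by exists V, rho; split=> //; exists x.
have [H [pi [pic]]] := G_rep; apply; apply/funext => x.
apply: contrapT => gx.
(* Quantifying over all intertwiners describes the orthogonal complement without forming a sum or a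
   maximal family of subrepresentations. *)
pose K : set H := [set y | forall (V : hilbertType R) (rho : unitary_rep G V)
  (J : {linear V -> H}), isometric_intertwiner rho pi J ->
  finite_dimensional V -> forall v, inner y (J v) = 0].
have Ksub : submod_closed (fun y => `[< K y >]).
  split=> [|a y z /asboolP Ky /asboolP Kz]; apply/asboolP => V rho J Jr fV v.
    by rewrite inner0l.
  by rewrite innerDl innerZl (Ky V rho J)// (Kz V rho J)// mulr0 addr0.
have Kcl : closed K.
  move=> y cly V rho J Jr fV v; apply/eqP; rewrite -rnorm_eq0 eq_le rnorm_ge0 andbT.
  apply/ler_addgt0Pr => e e0; rewrite add0r.
  have r0 : 0 < e / (rnorm (J v) + 1) by rewrite divr_gt0// ltr_wpDl ?rnorm_ge0.
  have /cvg_rnormP/(_ _ r0) ny : id @ nbhs y --> y by exact: cvg_id.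
  have [z [Kz yz]] := cly _ ny.
  have -> : inner y (J v) = inner (y - z) (J v).
    by rewrite innerBl (Kz V rho J)// subr0.
  rewrite (le_trans (cauchy_schwarz _ _))//.
  apply: (@le_trans _ _ (e / (rnorm (J v) + 1) * (rnorm (J v) + 1))).
    by rewrite ler_pM ?rnorm_ge0// ?lerDl//; exact: ltW.
  by rewrite divfK// gt_eqF// ltr_wpDl ?rnorm_ge0.
pose W : closed_subspace H := ClosedSubspace Ksub Kcl.
have Wpi k y : csubset W y -> csubset W (pi k y).
  move=> Ky V rho J Jr fV v; rewrite inner_repl -Jr.2; exact: Ky Jr fV _.
have gxK : K (pi g x - pi h x).
  move=> V rho J Jr fV v; have rc := intertwiner_norm_continuous Jr pic.
  (* Moving [pi g] and [pi h] across the inner product produces inverses, which are not separated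
     either. *)
  have inv_eq w : rho g^-1%g w = rho h^-1%g w.
    by rewrite -[RHS](repK rho g) nosep// repVK.
  by rewrite innerBl !inner_repl -!Jr.2 inv_eq subrr.
have [V [rho [J [Jr JW WJ]]]] := subrepresentation Wpi.
have [v Jv] := WJ _ gxK.
have [|V' [rho' [J' [Jr' fV' [w w0]]]]] :=
  finite_dim_subrepresentation G_amenable G_T (intertwiner_norm_continuous Jr pic).
  exists v; apply/eqP => v0; apply: gx; apply/eqP.
  by rewrite -subr_eq0 -Jv v0 linear0.
(* The new subrepresentation lies in [K], but embeds in [pi] through [J \o J']; its vectors are
   orthogonal to themselves. *)
have := JW (J' w) V' rho' _ (intertwiner_comp Jr' Jr) fV' w.
rewrite -[inner _ _]/(inner (J (J' w)) (J (J' w))) Jr.1 Jr'.1 => /inner_eq0.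
by move=> ww; move: w0; rewrite ww eqxx.
Qed.
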